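(* Let $\theta\ge2$ be an integer and let $X_{n,1}^{(\theta)}$ be the number of vertices contained in exactly one hyperedge in a hyperrecursive tree with hyperedges of size $\theta$ at age $n$. Then, as $n\to\infty$, $$\frac{X_{n,1}^{(\theta)}-\frac n\theta}{\sqrt n}\ \xrightarrow{\ \mathcal D\ }\ \mathcal N\Big(0,\frac{(\theta-1)^2}{\theta^2(2\theta-1)}\Big).$$
   Context: Hyperrecursive tree with hyperedge size $\theta$ (an integer $\theta\ge2$): at time $0$ there are $\theta$ originating vertices, all labeled $0$, which together form the first hyperedge. At each time $n\ge1$ a new vertex labeled $n$ is added; a subset of size $\theta-1$ of the $n-1+\theta$ existing vertices is chosen uniformly at random among all subsets of that size (independently of the past), and the new vertex together with the chosen vertices forms a new hyperedge. The structure at time $n$ (right after insertion of vertex $n$) is said to have age $n$. All vertices, including each originator, are counted; $X_{0,1}^{(\theta)}=\theta$. $\xrightarrow{\mathcal D}$ denotes convergence in distribution, and $\mathcal N(0,\sigma^2)$ the centered normal law with variance $\sigma^2$. *)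

(* Defs.v *)
From HB Require Import structures.
From mathcomp Require Import all_boot all_order all_algebra finmap.
From mathcomp Require Import all_classical all_reals all_analysis measurable_realfun.
Set Implicit Arguments.
Unset Strict Implicit.
Unset Printing Implicit Defensive.
Import Order.TTheory GRing.Theory Num.Theory.
Import numFieldNormedType.Exports.

Local Open Scope classical_set_scope.
Local Open Scope ring_scope.

HB.instance Definition _ := @isMeasurable.Build default_measure_display
  {fset nat} discrete_measurable discrete_measurable0
  discrete_measurableC discrete_measurableU.

(* Vertices are encoded by natural numbers, in order of insertion: the theta
   originators (which all carry the label 0 in the tree) are 0, ...,
   theta - 1, and the vertex labelled n >= 1 is n - 1 + theta. *)
Definition vertices (theta n : nat) : {fset nat} :=
  [fset v in iota 0 (n + theta)]%fset.

(* [chosen n] is the set of existing vertices that joins the vertex labelled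
   n + 1, so it is drawn from the structure of age n. *)
Record hyperrecursive_tree (R : realType) (d : measure_display)
    (T : measurableType d) (P : probability T R) (theta : nat) := {
  chosen : nat -> {RV P >-> {fset nat}};
  chosen_sub : forall n w, (chosen n w `<=` vertices theta n)%fset;
  card_chosen : forall n w, #|` chosen n w|%fset = (theta - 1)%N;
  chosen_uniform : forall n (A : {fset nat}),
    (A `<=` vertices theta n)%fset -> #|` A|%fset = (theta - 1)%N ->
    P (chosen n @^-1` [set A]) = (('C(n + theta, theta - 1))%:R^-1)%:E;
  chosen_indep_past : forall n (B : (set {fset nat})^nat),
    let past := \bigcap_(k in `I_n) (chosen k @^-1` B k) in
    P (past `&` chosen n @^-1` B n) = (P past * P (chosen n @^-1` B n))%E
}.

Section degrees.
Context (R : realType) (d : measure_display) (T : measurableType d).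
Context (P : probability T R) (theta : nat).
Variable H : hyperrecursive_tree P theta.

(* The hyperedge created at time n; the first one consists of the
   originators. *)
Definition hyperedge (n : nat) (w : T) : {fset nat} :=
  if n is m.+1 then ((m + theta)%N |` chosen H m w)%fset
  else vertices theta 0.

(* Hyperedges created at different times are different, as each of them
   contains a vertex that none of the previous ones has, so that counting
   times is counting hyperedges. *)
Definition degree (n v : nat) (w : T) : nat :=
  \sum_(k < n.+1) (v \in hyperedge k w).

Definition num_degree (j n : nat) (w : T) : R :=
  #|` [fset v in vertices theta n | degree n v w == j] |%fset%:R.

Lemma num_degreeE j n w :
  num_degree j n w = \sum_(v <- iota 0 (n + theta)) (degree n v w == j)%:R.
Proof.
rewrite /num_degree -natr_sum; congr (_%:R).
rewrite -big_mkcond sum1_count -size_filter; apply/perm_size/uniq_perm.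
- exact: fset_uniq.
- exact/filter_uniq/iota_uniq.
- by move=> v; rewrite !inE mem_filter /= andbC.
Qed.

Lemma measurable_hyperedge n v :
  measurable_fun setT (fun w => v \in hyperedge n w).
Proof.
case: n => [|n] /=; first exact: measurable_cst.
have -> : (fun w => v \in ((n + theta)%N |` chosen H n w)%fset) =
    (fun A : {fset nat} => v \in ((n + theta)%N |` A)%fset) \o chosen H n by [].
exact: measurableT_comp.
Qed.

Lemma measurable_degree n v : measurable_fun setT (degree n v).
Proof.
rewrite /degree; elim: n.+1 => [|m IH].
  by under eq_fun do rewrite big_ord0; exact: measurable_cst.
under eq_fun do rewrite big_ord_recr /=.
apply: measurable_fun_addn => //.
have -> : (fun w => (v \in hyperedge m w) : nat) =
  nat_of_bool \o (fun w => v \in hyperedge m w) by [].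
exact/measurableT_comp/measurable_hyperedge.
Qed.

Lemma measurable_num_degree j n : measurable_fun setT (num_degree j n).
Proof.
rewrite (_ : num_degree j n = (fun w =>
    \sum_(v <- iota 0 (n + theta)) (degree n v w == j)%:R)); last first.
  by apply/funext => w; exact: num_degreeE.
apply: measurable_sum => v.
have -> : (fun w => (degree n v w == j)%:R) =
  (fun k : nat => (k == j)%:R : R) \o degree n v by [].
exact/measurableT_comp/measurable_degree.
Qed.

HB.instance Definition _ j n :=
  isMeasurableFun.Build _ _ _ _ (num_degree j n) (measurable_num_degree j n).

End degrees.

Definition cvg_in_distribution (R : realType) (d : measure_display)
    (T : measurableType d) (P : probability T R) (X : nat -> {RV P >-> R})
    (mu : probability (measurableTypeR R) R) :=
  forall x : R, {for x, continuous (fun y : R => mu `]-oo, y]%classic)} ->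
    cdf (X n) x @[n --> \oo] --> mu `]-oo, x]%classic.

(* Main.v *)
(* If S is the set of vertices of degree one at age n, then 1 + #|S \ A|
   vertices have degree one at age n + 1, with A uniform of size theta - 1 among
   n + theta vertices; so Y_n = #|S| - (n + theta) / theta satisfies
   Y_(n+1) = (n + 1) / (n + theta) * Y_n + noise, where the noise is bounded and
   centred, with conditional variance tending to v = (theta - 1)^2 / theta^2
   in mean.
   Lindeberg's replacement is run backwards in time with the test functions
   x |-> Phi ((y - c x) / sqrt s), Phi the standard normal cdf: Gaussian
   convolution maps this family to itself (only s changes), so no convolution
   has to be computed, and Phi (./eps) is a smooth approximation of the
   indicator of a half-line.  The variances v c^2 accumulate to
   v / (2 theta - 1). *)

Require Import Defs.
From HB Require Import structures.
From mathcomp Require Import all_boot all_order all_algebra finmap.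
From mathcomp Require Import all_classical all_reals all_analysis measurable_realfun.
From mathcomp Require Import ring lra zify.
Set Implicit Arguments.
Unset Strict Implicit.
Unset Printing Implicit Defensive.
Import Order.TTheory GRing.Theory Num.Theory.
Import numFieldNormedType.Exports.

Local Open Scope classical_set_scope.
Local Open Scope ring_scope.

(** * The normal distribution function *)

Section normal_cdf.
Context {R : realType}.
Implicit Types s x : R.

(** Averaging out the draw at age k turns the parameters (c, s) of the test function into (c a, s +
    v c^2) with a = (k + 1) / (k + theta). Starting from c = n^(-1/2), the coefficient met at age k
    is about n^(-1/2) (k / n)^(theta - 1), so the sum of the v c^2 is a Riemann sum for v x^(2 theta
    - 2) on [0, 1]: hence 1 / (2 theta - 1). The obstacle is that the conditional variance of the
    noise is random. It depends on the proportion of vertices of degree one, whose distance to 1 /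
    theta is |Y_k| / (k + theta); as E Y_k^2 = O(k), the mean error at age k is O(k^(-1/2)).
    Weighted by c^2 <= 1 / n and summed over k < n it costs O(n^(-1/2)), the same order as the
    third-order remainders n c^3. The remainders need s bounded away from 0, so s starts at eps^2 >
    0, and eps shrinks only after n has gone to infinity. On the side of the tree, expectations are
    finite averages over lists of draws; measure theory enters only to find the law of such a
    list. *)

Definition normal_cdf s x : R := fine (normal_prob 0 s `]-oo, x]).

Lemma normal_cdfE s x : normal_prob 0 s `]-oo, x] = (normal_cdf s x)%:E.
Proof. by rewrite fineK// fin_num_measure. Qed.

(** The identity as a random variable under the normal law: its cdf is [normal_cdf s], so limits and
    monotonicity are those of any cdf. *)
Let idTR : measurableTypeR R -> R := idfun.

#[local] HB.instance Definition _ :=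
  @isMeasurableFun.Build _ _ _ _ idTR (@measurable_id _ _ setT).

Let cdf_idTR s : cdf (idTR : {RV (normal_prob 0 s) >-> R}) = EFin \o normal_cdf s.
Proof.
by apply/funext => x; rewrite /= -normal_cdfE /cdf /distribution /pushforward.
Qed.

Lemma normal_cdf_cvgNy s : normal_cdf s x @[x --> -oo] --> (0 : R).
Proof.
have := cvg_cdfNy0 (idTR : {RV (normal_prob 0 s) >-> R}).
by rewrite cdf_idTR => /fine_cvgP[].
Qed.

Lemma normal_cdf_cvgy s : normal_cdf s x @[x --> +oo] --> (1 : R).
Proof.
have := cvg_cdfy1 (idTR : {RV (normal_prob 0 s) >-> R}).
by rewrite cdf_idTR => /fine_cvgP[].
Qed.

Lemma normal_cdf_nondecreasing s : {homo normal_cdf s : x y / x <= y}.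
Proof.
move=> x y xy; have := cdf_nondecreasing (idTR : {RV (normal_prob 0 s) >-> R}) xy.
by rewrite cdf_idTR.
Qed.

Lemma normal_cdf_ge0 s x : 0 <= normal_cdf s x.
Proof. by rewrite -lee_fin -normal_cdfE measure_ge0. Qed.

Lemma normal_cdf_le1 s x : normal_cdf s x <= 1.
Proof. by rewrite -lee_fin -normal_cdfE probability_le1. Qed.

Lemma is_derive_normal_cdf s x : s != 0 ->
  is_derive x 1 (normal_cdf s) (normal_pdf 0 s x).
Proof.
move=> s0.
have [] := @continuous_FTC1 R (normal_pdf 0 s) -oo%O x (x + 1).
- by rewrite ltrDl.
- by apply: integrableS (integrable_normal_pdf 0 s).
- by rewrite ltNyr.
- exact: continuous_normal_pdf.
by move=> dF <-; rewrite derive1E; exact: derivableP.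
Qed.

Lemma normal_pdf_scale s x : 0 < s ->
  normal_pdf 0 s x = s^-1 * normal_pdf 0 1 (x / s).
Proof.
move=> s0; have s0' : s != 0 by rewrite gt_eqF.
rewrite !normal_pdfE ?oner_neq0// mulrA; congr (_ * _).
  rewrite /normal_peak expr1n mul1r -mulrnAr sqrtrM ?sqr_ge0//.
  by rewrite sqrtr_sqr gtr0_norm// invfM.
by rewrite /normal_fun; congr expR; rewrite !subr0 expr1n; field.
Qed.

(** Both sides have the same derivative, so they differ by a constant, which is 0 because both
    vanish at minus infinity. *)
Lemma normal_cdf_scale s x : 0 < s -> normal_cdf s x = normal_cdf 1 (x / s).
Proof.
move=> s0; have s0' : s != 0 by rewrite gt_eqF.
pose D := normal_cdf s - (normal_cdf 1 \o (fun x => x / s)).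
have D_cst y : D y = D x.
  apply: is_derive_0_is_cst => z.
  have h1 := is_derive_normal_cdf z s0'.
  have h2 := is_derive_normal_cdf (z / s) (oner_neq0 R).
  have h3 : is_derive z 1 (fun x : R => x / s) s^-1.
    rewrite (_ : (fun _ => _) = s^-1 \*: id); last first.
      by apply/funext => t /=; rewrite mulrC.
    by apply: is_derive_eq; rewrite /GRing.scale/= mulr1.
  apply: is_derive_eq.
  by rewrite normal_pdf_scale// mulrC subrr.
have D0 : D y @[y --> -oo] --> (0 : R).
  rewrite -[X in _ --> X](subrr 0); apply: cvgB; first exact: normal_cdf_cvgNy.
  apply: cvg_comp (normal_cdf_cvgNy 1).
  by apply: gt0_cvgMlNy; [rewrite invr_gt0|exact: cvg_id].
have : D y @[y --> -oo] --> D x.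
  by under eq_fun do rewrite D_cst; exact: cvg_cst.
move=> cDx; apply: subr0_eq.
exact: (cvg_unique (@norm_hausdorff _ R^o) cDx D0).
Qed.

End normal_cdf.

(** * Taylor estimates *)

Section mean_value.
Context {R : realType}.
Implicit Types f df : R -> R.

Lemma is_derive1_continuous f (x d : R) :
  is_derive x (1 : R) f d -> {for x, continuous f}.
Proof. by move=> [dfx _]; exact/differentiable_continuous/derivable1_diffP. Qed.

Lemma MVT_line f df (z h : R) : (forall x, is_derive x (1 : R) f (df x)) ->
  exists2 t, 0 <= t <= 1 & f (z + h) - f z = df (z + t * h) * h.
Proof.
move=> fdf; pose g t := f (z + t * h).
have gdg t : is_derive t (1 : R) g (df (z + t * h) * h).
  have dl : is_derive t (1 : R) (fun t : R => z + t * h) h.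
    rewrite (_ : (fun _ => _) = cst z + h \*: id); last first.
      by apply/funext => u /=; rewrite mulrC.
    by apply: is_derive_eq; rewrite /GRing.scale/= mulr1 add0r.
  exact: is_derive1_comp.
have [|c] := @MVT_segment R g (fun t => df (z + t * h) * h) 0 1 ler01.
  by apply: continuous_subspaceT => x; exact: is_derive1_continuous (gdg x).
rewrite in_itv/= => c01; rewrite /g mul1r mul0r addr0 subr0 mulr1 => ->.
by exists c.
Qed.

Lemma derive_bound_lipschitz f df (M : R) : (forall x, is_derive x (1 : R) f (df x)) ->
  (forall x, `|df x| <= M) -> forall x y, `|f y - f x| <= M * `|y - x|.
Proof.
move=> fdf dfM x y; have [t _] := @MVT_line f df x (y - x) fdf.
rewrite subrKC => ->.
by rewrite normrM ler_wpM2r.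
Qed.

(** The remainder [F], as a function of the increment, and its derivative [G] both vanish at 0, so
    two mean value steps reduce the bound to an increment of [f2]. *)
Lemma taylor2_bound f f1 f2 (M : R) :
  (forall x, is_derive x (1 : R) f (f1 x)) -> (forall x, is_derive x (1 : R) f1 (f2 x)) ->
  (forall x y, `|f2 y - f2 x| <= M * `|y - x|) ->
  forall z h, `|f (z + h) - f z - h * f1 z - h ^+ 2 / 2 * f2 z| <= M * `|h| ^+ 3.
Proof.
move=> ff1 f12 f2M z h.
pose G k := f1 (z + k) - f1 z - k * f2 z.
pose F k := f (z + k) - f z - k * f1 z - k ^+ 2 / 2 * f2 z.
have shift (g dg : R -> R) (k : R) : (forall x, is_derive x (1 : R) g (dg x)) ->
    is_derive k (1 : R) (fun k : R => g (z + k)) (dg (z + k)).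
  move=> gdg; have dl : is_derive k (1 : R) (fun t : R => z + t) (1 : R).
    rewrite (_ : (fun _ => _) = cst z + id)//.
    by apply: is_derive_eq; rewrite add0r.
  by have := is_derive1_comp (gdg (z + k)) dl; rewrite mulr1.
have FG k : is_derive k (1 : R) F (G k).
  have h1 := shift _ _ k ff1.
  rewrite (_ : F = (fun k : R => f (z + k)) - cst (f z) - f1 z \*: id
    - (f2 z / 2) \*: (id ^+ 2 : R -> R)); last first.
    by apply/funext => u; rewrite /F !fctE/= /GRing.scale/=; ring.
  by apply: is_derive_eq; rewrite /GRing.scale/= /G; field.
have GG k : is_derive k (1 : R) G (f2 (z + k) - f2 z).
  have h1 := shift _ _ k f12.
  rewrite (_ : G = (fun k : R => f1 (z + k)) - cst (f1 z) - f2 z \*: id); last first.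
    by apply/funext => u; rewrite /G !fctE/= /GRing.scale/=; ring.
  by apply: is_derive_eq; rewrite /GRing.scale/=; ring.
have [t t01] := MVT_line 0 h FG.
have F0 : F 0 = 0 by rewrite /F addr0; ring.
rewrite add0r F0 subr0 add0r -/(F h) => ->.
have [u u01] := MVT_line 0 (t * h) GG.
have G0 : G 0 = 0 by rewrite /G addr0; ring.
rewrite add0r G0 subr0 add0r => ->.
have {}t01 : `|t| <= 1 by case/andP: t01 => *; rewrite ger0_norm.
have {}u01 : `|u| <= 1 by case/andP: u01 => *; rewrite ger0_norm.
have M0 : 0 <= M.
  by have := f2M 0 1; rewrite subr0 normr1 mulr1; exact: le_trans.
have hM : `|f2 (z + u * (t * h)) - f2 z| <= M * `|h|.
  apply: le_trans (f2M _ _) _; rewrite ler_wpM2l// (addrC z) addrK !normrM mulrA.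
  by rewrite ler_piMl// mulr_ile1.
rewrite !normrM (_ : M * _ = M * `|h| * `|h| * `|h|); last by ring.
apply: ler_wpM2r => //; apply: ler_pM => //; last by rewrite ler_piMl.
Qed.

End mean_value.

(** * The Gaussian heat kernel *)

Section gaussian_heat_kernel.
Context {R : realType}.
Local Notation Phi := (@normal_cdf R 1).
Local Notation phi := (@normal_pdf R 0 1).

Let one_neq0 : (1 : R) != 0. Proof. exact: oner_neq0. Qed.

Lemma normal_pdf01E (z : R) : phi z = normal_peak 1 * expR (- (z ^+ 2 / 2)).
Proof.
by rewrite normal_pdfE// /normal_fun subr0 expr1n mulNr.
Qed.

Lemma is_derive_normal_pdf01 (z : R) : is_derive z (1 : R) phi (- z * phi z).
Proof.
have -> : phi = normal_peak 1 \*: (expR \o ((- 2^-1) \*: (id ^+ 2 : R -> R))).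
  apply/funext => x; rewrite normal_pdf01E/= /GRing.scale/= !fctE/= mulNr.
  by rewrite (mulrC 2^-1).
by apply: is_derive_eq; rewrite /GRing.scale/= !fctE/= /GRing.scale/=; field.
Qed.

Lemma normal_pdf01_bound (z : R) k : (k <= 4)%N -> `|z| ^+ k * phi z <= 17.
Proof.
move=> k4.
have peak1 : normal_peak (1 : R) <= 1.
  rewrite /normal_peak invf_le1 ?sqrtr_gt0 expr1n mul1r; last first.
    by rewrite pmulrn_lgt0// pi_gt0.
  have pi2 : (1 : R) <= pi *+ 2 by rewrite mulr2n; have := @pi_ge2 R; lra.
  by rewrite -[leLHS]sqrtr1 ler_sqrt// (le_trans _ pi2).
have zk : `|z| ^+ k <= 1 + `|z| ^+ 4.
  have [z1|z1] := leP `|z| 1.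
    have zk1 : `|z| ^+ k <= 1 by exact: exprn_ile1.
    by apply: le_trans zk1 _; rewrite lerDl exprn_ge0.
  by apply: le_trans (ler_weXn2l (ltW z1) k4) _; rewrite lerDr.
(* 17 is 1 + 16: if e is the exponential of z^2 / 4, then e >= 1 + z^2 / 4 gives 16 e^2 >= (4 +
   z^2)^2 >= z^4, and e^2 >= 1. *)
have zE : 1 + `|z| ^+ 4 <= 17 * expR (z ^+ 2 / 2).
  have -> : z ^+ 2 / 2 = z ^+ 2 / 4 + z ^+ 2 / 4 by field.
  rewrite expRD.
  have /= e1 := expR_ge1Dx (z ^+ 2 / 4).
  have -> : `|z| ^+ 4 = (z ^+ 2) ^+ 2 by rewrite (exprM _ 2 2) real_normK ?num_real.
  have z0 := sqr_ge0 z; move: (z ^+ 2) (expR _) z0 e1 => t e t0 te.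
  by nra.
rewrite normal_pdf01E.
have e0 := expR_gt0 (- (z ^+ 2 / 2)).
have ee : expR (z ^+ 2 / 2) * expR (- (z ^+ 2 / 2)) = 1.
  by rewrite -expRD subrr expR0.
apply: (@le_trans _ _ (`|z| ^+ k * expR (- (z ^+ 2 / 2)))).
  by rewrite ler_wpM2l// ler_piMl// ltW.
apply: (@le_trans _ _ (17 * expR (z ^+ 2 / 2) * expR (- (z ^+ 2 / 2)))).
  by rewrite ler_wpM2r ?(ltW e0)// (le_trans zk).
by rewrite -mulrA ee mulr1.
Qed.

Lemma normal_cdf_taylor2 (z h : R) :
  `|Phi (z + h) - Phi z - h * phi z - h ^+ 2 / 2 * (- z * phi z)| <= 34 * `|h| ^+ 3.
Proof.
apply: (@taylor2_bound R Phi phi (fun x => - x * phi x)) => [x|x|].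
- exact: is_derive_normal_cdf.
- exact: is_derive_normal_pdf01.
(* The third derivative of [Phi] is [(x ^+ 2 - 1) * phi x], bounded by 17 + 17. *)
apply: (@derive_bound_lipschitz _ _ (fun x => (x ^+ 2 - 1) * phi x)) => x.
  have h1 := is_derive_normal_pdf01 x.
  rewrite (_ : (fun _ => _) = - (id * phi : R -> R)); last first.
    by apply/funext => t; rewrite !fctE/= mulNr.
  by apply: is_derive_eq; rewrite /GRing.scale/=; ring.
have p0 := normal_pdf_ge0 0 1 x.
have := @normal_pdf01_bound x 2 isT; have := @normal_pdf01_bound x 0 isT.
rewrite expr0 mul1r real_normK ?num_real// => b0 b2.
by rewrite ler_norml; apply/andP; split; nra.
Qed.

(* [z^2 phi(z)] with [z = w / sqrt s] enters because [s |-> Phi (w / sqrt s)]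
   has derivative [- z phi(z) / (2 s)], i.e. half the second derivative of
   [Phi (. / sqrt s)] at [w]. *)
Lemma normal_cdf_heat (eta s d w z : R) : 0 < eta -> eta <= s -> 0 <= d ->
  z = w / Num.sqrt s ->
  `|Phi (w / Num.sqrt (s + d)) - Phi z + d / (2 * s) * (z * phi z)|
    <= 17 / eta ^+ 2 * d ^+ 2.
Proof.
move=> eta0 etas d0 zE.
pose Z (x : R) := w * (Num.sqrt x)^-1.
pose k (x : R) := Z x * phi (Z x) / x.
have s0 : 0 < s by exact: lt_le_trans etas.
have dZ (x : R) : 0 < x -> is_derive x (1 : R) Z (- Z x / (2 * x)).
  move=> x0; have x0' : x != 0 by rewrite gt_eqF.
  have sx0 : Num.sqrt x != 0 by rewrite gt_eqF// sqrtr_gt0.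
  have h1 := is_derive1_sqrt x0.
  have h2 : is_derive x (1 : R) (fun y : R => (Num.sqrt y)^-1)
     (- (Num.sqrt x) ^- 2 *: (2 * Num.sqrt x)^-1) by exact: is_deriveV.
  rewrite (_ : Z = w \*: (fun y : R => (Num.sqrt y)^-1))//.
  apply: is_derive_eq; rewrite /GRing.scale/= /Z.
  have : x = Num.sqrt x ^+ 2 by rewrite sqr_sqrtr// ltW.
  by move: (Num.sqrt x : R) sx0 => r r0 ->; rewrite /GRing.scale/=; field.
have dPhi (x : R) : 0 < x -> is_derive x (1 : R) (Phi \o Z) (- k x / 2).
  move=> x0; have x0' : x != 0 by rewrite gt_eqF.
  have h1 := dZ x x0; have h2 := @is_derive_normal_cdf R 1 (Z x) one_neq0.
  by apply: is_derive_eq; rewrite /k; field.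
have dk (x : R) : 0 < x -> is_derive x (1 : R) k
    ((Z x ^+ 3 - 3 * Z x) * phi (Z x) / (2 * x ^+ 2)).
  move=> x0; have x0' : x != 0 by rewrite gt_eqF.
  have h1 := dZ x x0; have h2 := is_derive_normal_pdf01 (Z x).
  have h3 : is_derive x (1 : R) (fun y : R => y^-1) (- x ^- 2 *: 1).
    exact: (is_deriveV x0' (is_derive_id x (1 : R))).
  rewrite (_ : k = Z * (phi \o Z) * (fun y : R => y^-1))//.
  by apply: is_derive_eq; rewrite /GRing.scale/= !fctE/=; field.
(* 17 for the cubic term and 51 for three times the linear one make 68, halved by the denominator
   [2 * x ^+ 2]. *)
have dkM (x : R) : eta <= x ->
    `|(Z x ^+ 3 - 3 * Z x) * phi (Z x) / (2 * x ^+ 2)| <= 34 / eta ^+ 2.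
  move=> ex; have x0 : 0 < x by exact: lt_le_trans ex.
  move: (Z x) => {zE}z; have p0 := normal_pdf_ge0 0 1 z.
  have := @normal_pdf01_bound z 3 isT; have := @normal_pdf01_bound z 1 isT.
  rewrite expr1 => b1 b3.
  have q0 : 0 <= 2 * x ^+ 2 by rewrite mulr_ge0 ?sqr_ge0.
  rewrite normrM normfV (ger0_norm q0).
  apply: (@le_trans _ _ (68 / (2 * x ^+ 2))).
    rewrite ler_wpM2r ?invr_ge0// normrM (ger0_norm p0).
    apply: (@le_trans _ _ ((`|z| ^+ 3 + 3 * `|z|) * phi z)).
      rewrite ler_wpM2r// (le_trans (ler_normB _ _))//.
      by rewrite normrX normrM normr_nat.
    by rewrite mulrDl -mulrA; lra.
  rewrite invfM mulrA (_ : 68 / 2 = 34); last by field.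
  by rewrite ler_wpM2l// lef_pV2 ?posrE ?exprn_gt0// ler_sqr ?nnegrE
    ?(ltW x0) ?(ltW eta0).
have sd0 : 0 < s + d by rewrite ltr_wpDr.
have pos (c : R) : s <= c -> 0 < c by exact: lt_le_trans.
(* [Z] is differentiable only at positive arguments, so the mean value theorem is used on segments:
   for [Phi \o Z] on [[s, s + d]], then for [k] on [[s, c]]. *)
have [|||c /itvP sc] := @MVT_segment R (Phi \o Z) (fun x => - k x / 2) s (s + d).
  by rewrite lerDl.
  by move=> x /itvP sx; apply/dPhi/pos; rewrite ltW ?sx.
  apply: continuous_in_subspaceT => x /set_mem /= /itvP sx.
  by apply: is_derive1_continuous (dPhi x _); apply: pos; rewrite sx.
have [|||c' /itvP sc'] := @MVT_segment R k
    (fun x => (Z x ^+ 3 - 3 * Z x) * phi (Z x) / (2 * x ^+ 2)) s c.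
  by rewrite sc.
  by move=> x /itvP sx; apply/dk/pos; rewrite ltW ?sx.
  apply: continuous_in_subspaceT => x /set_mem /= /itvP sx.
  by apply: is_derive1_continuous (dk x _); apply: pos; rewrite sx.
move=> kE PhiE.
have c0 : 0 < c by apply: pos; rewrite sc.
have s0' : s != 0 by rewrite gt_eqF.
have c0' : c != 0 by rewrite gt_eqF.
have -> : Phi (w / Num.sqrt (s + d)) - Phi z + d / (2 * s) * (z * phi z)
    = - (k c - k s) / 2 * d.
  rewrite -[Phi (w / _)]/((Phi \o Z) (s + d)) zE -[Phi (w / Num.sqrt s)]/((Phi \o Z) s).
  rewrite PhiE /k -/(Z s).
  by move: (phi (Z s)) (phi (Z c)) (Z s) (Z c) => *; field; rewrite s0'.
rewrite kE.
have ec' : eta <= c' by rewrite (le_trans etas)// sc'.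
have := dkM c' ec'; move: (_ / (2 * c' ^+ 2)) => q qM.
have cs0 : 0 <= c - s by rewrite subr_ge0 sc.
have csd : c - s <= d by rewrite lerBlDl sc.
rewrite normrM (ger0_norm d0) normrM normrN normrM (ger0_norm cs0).
rewrite (ger0_norm (_ : 0 <= 2^-1)) ?invr_ge0//.
rewrite expr2 mulrA ler_wpM2r//.
rewrite [leRHS](_ : _ = 34 / eta ^+ 2 * d / 2); last first.
  by field; rewrite gt_eqF.
by rewrite ler_wpM2r ?invr_ge0// ler_pM.
Qed.

(* One Lindeberg step: moving the centre [w] by a centred random [- D] while
   the variance drops from [s + d] to [s] changes the expectation of [Phi] only
   by the mismatch between [d] and the variance of [D], up to higher order. *)
Lemma normal_cdf_lindeberg_step (eta : R) : 0 < eta ->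
  exists2 K : R, 0 < K & forall s d w, eta <= s -> 0 <= d ->
    exists p q : R, `|q| <= K /\ forall D,
      `|Phi ((w - D) / Num.sqrt s) - Phi (w / Num.sqrt (s + d))
        - p * D - q * (D ^+ 2 - d)| <= K * (`|D| ^+ 3 + d ^+ 2).
Proof.
move=> eta0; have se0 : 0 < Num.sqrt eta by rewrite sqrtr_gt0.
pose K1 := 34 / Num.sqrt eta ^+ 3; pose K2 := 17 / eta ^+ 2; pose K3 := 17 / eta.
have K10 : 0 < K1 by rewrite divr_gt0// exprn_gt0.
have K20 : 0 < K2 by rewrite divr_gt0// exprn_gt0.
have K30 : 0 < K3 by rewrite divr_gt0.
exists (K1 + K2 + K3); first by rewrite !addr_gt0.
move=> s d w etas d0.
have s0 : 0 < s by exact: lt_le_trans etas.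
have ss0 : 0 < Num.sqrt s by rewrite sqrtr_gt0.
pose z := w / Num.sqrt s.
(* The first and half the second derivative of [Phi ((w - D) / Num.sqrt s)] in [D] at 0. By the heat
   equation [q * d] is also the first-order effect of raising the variance from [s] to [s + d],
   which is why [D ^+ 2] and [d] share a coefficient. *)
exists (- (phi z / Num.sqrt s)), (- (z * phi z / (2 * s))).
have s0' : s != 0 by rewrite gt_eqF.
split.
  have p0 := normal_pdf_ge0 0 1 z.
  have := @normal_pdf01_bound z 1 isT; rewrite expr1 => zp.
  apply: (@le_trans _ _ K3); last by rewrite lerDr addr_ge0 ?ltW.
  have -> : z * phi z / (2 * s) = z * phi z / s / 2 by field.
  rewrite normrN normrM (ger0_norm (_ : 0 <= 2^-1)) ?invr_ge0//.
  rewrite normrM normfV (gtr0_norm s0) normrM (ger0_norm p0).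
  have : `|z| * phi z / s <= K3.
    apply: ler_pM => //; first by rewrite mulr_ge0.
      by rewrite invr_ge0 ltW.
    by rewrite lef_pV2.
  by lra.
move=> D.
have := normal_cdf_taylor2 z (- (D / Num.sqrt s)).
have := normal_cdf_heat eta0 etas d0 (erefl z).
have -> : (w - D) / Num.sqrt s = z + - (D / Num.sqrt s) by rewrite mulrBl.
rewrite (_ : (- (D / Num.sqrt s)) ^+ 2 = D ^+ 2 / s); last first.
  by rewrite sqrrN expr_div_n sqr_sqrtr// ltW.
rewrite normrN normrM normfV (gtr0_norm ss0) expr_div_n.
move: (Phi (_ + _)) (Phi (w / _)) => A B hH hT.
rewrite (_ : A - B - _ - _ =
  (A - Phi z - - (D / Num.sqrt s) * phi z - D ^+ 2 / s / 2 * (- z * phi z))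
  - (B - Phi z + d / (2 * s) * (z * phi z))); last first.
  by field; rewrite s0' gt_eqF.
apply: (le_trans (ler_normB _ _)).
apply: (le_trans (lerD hT hH)).
have hK1 : 34 * (`|D| ^+ 3 / Num.sqrt s ^+ 3) <= K1 * `|D| ^+ 3.
  rewrite mulrCA mulrC ler_wpM2r ?exprn_ge0// /K1 ler_wpM2l//.
  by rewrite lef_pV2 ?posrE ?exprn_gt0// lerXn2r ?nnegrE ?sqrtr_ge0// ler_wsqrtr.
have D3 : 0 <= `|D| ^+ 3 by rewrite exprn_ge0.
have d2 := sqr_ge0 d.
have := mulr_ge0 (ltW K20) D3; have := mulr_ge0 (ltW K30) D3.
have := mulr_ge0 (ltW K10) d2; have := mulr_ge0 (ltW K30) d2.
by rewrite -/K2 !mulrDl !mulrDr; lra.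
Qed.

End gaussian_heat_kernel.

(** * Uniform subsets of fixed size *)

Section draws.
Local Open Scope fset_scope.
Implicit Types (m : nat) (V W A S : {fset nat}).

Definition draws m V : {fset {fset nat}} :=
  [fset A in fpowerset V | #|` A| == m].

Lemma mem_draws m V A : (A \in draws m V) = (A `<=` V) && (#|` A| == m).
Proof. by rewrite !inE /= fpowersetE. Qed.

Lemma card_draws_fset m V : #|` draws m V| = 'C(#|` V|, m).
Proof.
rewrite (cardfE V) -card_draws cardE -(size_map (fsub V)).
apply/perm_size/uniq_perm; rewrite ?enum_uniq//.
  rewrite map_inj_in_uniq ?fset_uniq// => A B; rewrite !mem_draws.
  move=> /andP[AV _] /andP[BV _].
  exact: fsub_inj.
move=> Y; rewrite mem_enum inE; apply/mapP/idP => [[A]|Ym].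
  by rewrite mem_draws => /andP[AV] /eqP <- ->; rewrite card_fsub.
exists [fsetval y in Y].
  rewrite mem_draws; apply/andP; split.
    by apply/fsubsetP => x /in_fset_valP[].
  by rewrite card_imfset/=; [rewrite -cardE|exact: val_inj].
by apply/setP => y; rewrite !inE.
Qed.

(** The draws from [V] that avoid [W] are the draws from the difference. With one or two vertices in
    [W] this yields the first two moments below. *)
Lemma sum_draws_avoid m V W :
  (\sum_(A <- draws m V) [disjoint A & W]%fset = 'C(#|` V `\` W|, m))%N.
Proof.
rewrite -card_draws_fset -sum1_size -big_mkcond/= big_fset_condE/=.
apply: eq_fbigl => A; rewrite !inE/= fpowersetCE fpowersetE.
by rewrite andbAC.
Qed.

Lemma card_fsetD_sum A S : #|` S `\` A| = (\sum_(i <- S) (i \notin A))%N.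
Proof.
rewrite -sum1_size -[RHS]big_mkcond/= [RHS]big_fset_condE/=.
by apply: eq_fbigl => i; rewrite !inE/= andbC.
Qed.

Lemma sum_card_fsetD m V S : S `<=` V ->
  (\sum_(A <- draws m V) #|` S `\` A| = #|` S| * 'C(#|` V|.-1, m))%N.
Proof.
move=> /fsubsetP SV; under eq_bigr do rewrite card_fsetD_sum.
rewrite exchange_big/= -sum1_size big_distrl/= !big_seq.
apply: eq_bigr => i /SV iV; rewrite mul1n.
under eq_bigr do rewrite -fdisjointX1.
by rewrite sum_draws_avoid (cardfsD1 i V) iV.
Qed.

(** The square is a sum over ordered pairs of vertices of [S]: a diagonal pair forbids one vertex to
    the draw, any other pair forbids two. *)
Lemma sum_card_fsetD_sqr m V S : S `<=` V ->
  (\sum_(A <- draws m V) #|` S `\` A| ^ 2 =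
    #|` S| * ('C(#|` V|.-1, m) + #|` S|.-1 * 'C(#|` V|.-2, m)))%N.
Proof.
move=> /fsubsetP SV.
under eq_bigr do rewrite card_fsetD_sum -mulnn big_distrlr/=.
rewrite exchange_big/= -[X in (X * _)%N]sum1_size big_distrl/= !big_seq.
apply: eq_bigr => i iS; have iV := SV i iS; rewrite mul1n exchange_big/=.
have avoid2 j : (\sum_(A <- draws m V) (i \notin A) * (j \notin A) =
    'C(#|` V `\` [fset i; j]|, m))%N.
  under eq_bigr do rewrite mulnb -!fdisjointX1 -fdisjointXU.
  exact: sum_draws_avoid.
under eq_bigr do rewrite avoid2.
rewrite (big_fsetD1 i)//=; congr addn.
  by rewrite fsetUid (cardfsD1 i V) iV.
rewrite (cardfsD1 i S) iS add1n/= -sum1_size big_distrl/= !big_seq.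
apply: eq_bigr => j; rewrite !inE mul1n => /andP[ji /SV jV].
have V2 : #|` [fset i; j]| = 2 by rewrite cardfs2 eq_sym ji.
rewrite cardfsDS ?V2 ?subn2//.
by apply/fsubsetP => x; rewrite !inE => /orP[]/eqP->.
Qed.

End draws.

(** * Averages over a uniform draw *)

Section draw_mean.
Context {R : realType}.
Variable theta : nat.
Hypothesis theta2 : (2 <= theta)%N.

Lemma vertices_card n : #|` vertices theta n|%fset = (n + theta)%N.
Proof.
rewrite /vertices -[RHS](size_iota 0).
by apply/perm_size/uniq_perm; rewrite ?fset_uniq ?iota_uniq// => x; rewrite !inE.
Qed.

Lemma mem_vertices n v : (v \in vertices theta n) = (v < n + theta)%N.
Proof. by rewrite !inE/= mem_iota. Qed.

Definition draw_mean n (F : {fset nat} -> R) : R :=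
  (\sum_(A <- draws (theta - 1) (vertices theta n)) F A) /
    'C(n + theta, theta - 1)%:R.

Lemma bin_draws_gt0 n : 0 < 'C(n + theta, theta - 1)%:R :> R.
Proof. by rewrite ltr0n bin_gt0 (leq_trans (leq_subr _ _)) ?leq_addl. Qed.

Lemma draw_mean_cst n (c : R) : draw_mean n (fun=> c) = c.
Proof.
rewrite /draw_mean big_const_seq count_predT iter_addr_0 card_draws_fset vertices_card.
rewrite -[c *+ _]mulr_natr mulfK// gt_eqF// bin_draws_gt0//.
Qed.

Lemma draw_meanD n F G :
  draw_mean n (fun A => F A + G A) = draw_mean n F + draw_mean n G.
Proof. by rewrite /draw_mean big_split mulrDl. Qed.

Lemma draw_meanZ n c F : draw_mean n (fun A => c * F A) = c * draw_mean n F.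
Proof. by rewrite /draw_mean -big_distrr mulrA. Qed.

Lemma le_draw_mean n F G :
  (forall A, A \in draws (theta - 1) (vertices theta n) -> F A <= G A) ->
  draw_mean n F <= draw_mean n G.
Proof.
move=> FG; rewrite /draw_mean ler_pM2r ?invr_gt0 ?bin_draws_gt0//.
by rewrite !big_seq; exact: ler_sum.
Qed.

Lemma draw_mean_fsetD n (S : {fset nat}) : (S `<=` vertices theta n)%fset ->
  draw_mean n (fun A => #|` S `\` A|%fset%:R) =
    #|` S|%fset%:R * (n%:R + 1) / (n + theta)%:R.
Proof.
move=> SV; rewrite /draw_mean -natr_sum sum_card_fsetD// vertices_card.
have C0 := bin_draws_gt0 n; have N0 : 0 < (n + theta)%:R :> R.
  by rewrite ltr0n addn_gt0 (ltnW theta2) orbT.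
(* A given vertex is missed with probability (n + 1) / (n + theta), the ratio of these two
   binomials, since n + theta - (theta - 1) = n + 1. *)
have : (n + theta)%:R * 'C((n + theta).-1, theta - 1)%:R =
    (n%:R + 1) * 'C(n + theta, theta - 1)%:R :> R.
  by rewrite natr1 -!natrM mul_bin_down; congr (_ * _)%:R; lia.
move: N0; rewrite natrM; move: (n + theta)%:R => N N0 e1.
by rewrite (canRL (mulKf _) e1) ?gt_eqF//; field; rewrite !gt_eqF.
Qed.

Lemma draw_mean_fsetD_sqr n (S : {fset nat}) (K N : R) :
  (S `<=` vertices theta n)%fset -> K = #|` S|%fset%:R -> N = (n + theta)%:R ->
  draw_mean n (fun A => #|` S `\` A|%fset%:R ^+ 2) =
    K * (n%:R + 1) / N + K * (K - 1) * (n%:R + 1) * n%:R / (N * (N - 1)).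
Proof.
move=> SV -> NE; rewrite /draw_mean.
under eq_bigr do rewrite -natrX.
rewrite -natr_sum sum_card_fsetD_sqr// vertices_card.
have C0 := bin_draws_gt0 n; have N0 : 0 < N by rewrite NE ltr0n; lia.
have N10 : 0 < N - 1 by rewrite subr_gt0 NE ltr1n; lia.
have e1 : N * 'C((n + theta).-1, theta - 1)%:R =
    (n%:R + 1) * 'C(n + theta, theta - 1)%:R :> R.
  by rewrite NE natr1 -!natrM mul_bin_down; congr (_ * _)%:R; lia.
have e2 : (N - 1) * 'C((n + theta).-2, theta - 1)%:R =
    n%:R * 'C((n + theta).-1, theta - 1)%:R :> R.
  rewrite (_ : N - 1 = (n + theta).-1%:R); last first.
    by apply/eqP; rewrite subr_eq natr1 NE; apply/eqP; congr _%:R; lia.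
  by rewrite -!natrM mul_bin_down; congr (_ * _)%:R; lia.
(* The truncated predecessor differs from the subtraction in [R] only for empty [S], where the other
   factor is 0. *)
have e3 : #|` S|%fset%:R * #|` S|%fset.-1%:R =
    #|` S|%fset%:R * (#|` S|%fset%:R - 1) :> R.
  by case: #|` S|%fset => [|k]; rewrite ?mul0r// -natr1 addrK.
rewrite natrM natrD natrM mulrDr [X in _ + X]mulrA e3.
rewrite (canRL (mulKf _) e2) ?gt_eqF// (canRL (mulKf _) e1) ?gt_eqF//.
by field; rewrite !gt_eqF.
Qed.

End draw_mean.

(** * Histories of the tree *)

Section history_mean.
Context {R : realType}.
Variable theta : nat.
Hypothesis theta2 : (2 <= theta)%N.
Local Notation history := (seq {fset nat}).
Local Notation draw_mean := (@draw_mean R theta).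

(* A history lists the chosen sets with the most recent one first; [leaves h]
   are the vertices of degree one after history [h]. *)
Fixpoint leaves (h : history) : {fset nat} :=
  if h is A :: h' then ((size h' + theta)%N |` (leaves h' `\` A))%fset
  else vertices theta 0.

Fixpoint valid_history (h : history) : bool :=
  if h is A :: h' then
    (A \in draws (theta - 1) (vertices theta (size h'))) && valid_history h'
  else true.

Lemma leaves_sub h : (leaves h `<=` vertices theta (size h))%fset.
Proof.
elim: h => [|A h /fsubsetP IH]//=; apply/fsubsetP => v.
rewrite in_fset1U in_fsetD mem_vertices => /orP[/eqP->|/andP[_ /IH]].
  by rewrite addSn.
by rewrite mem_vertices => /ltn_trans; apply; rewrite addSn.
Qed.

Lemma card_leaves_cons A h :
  #|` leaves (A :: h)|%fset = #|` leaves h `\` A|%fset.+1.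
Proof.
rewrite /= cardfsU1 inE negb_and orbC; case: (boolP (_ \in leaves h)) => //.
by move/fsubsetP: (leaves_sub h) => /[apply]; rewrite mem_vertices ltnn.
Qed.

(** The most recent draw is averaged out first, so conditioning on the past amounts to unfolding one
    step. *)
Fixpoint history_mean n (F : history -> R) : R :=
  if n is m.+1 then history_mean m (fun h => draw_mean m (fun A => F (A :: h)))
  else F [::].

Lemma le_history_mean n F G :
  (forall h, valid_history h -> size h = n -> F h <= G h) ->
  history_mean n F <= history_mean n G.
Proof.
elim: n F G => [|n IH] F G FG /=; first exact: FG.
apply: IH => h vh hn; apply: le_draw_mean => // A Ad.
by apply: FG => /=; rewrite ?vh ?hn ?Ad.
Qed.

Lemma eq_history_mean n F G :
  (forall h, valid_history h -> size h = n -> F h = G h) ->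
  history_mean n F = history_mean n G.
Proof.
by move=> FG; apply/le_anti/andP; split; apply: le_history_mean => h vh hn;
  rewrite FG.
Qed.

Lemma history_mean_cst n (c : R) : history_mean n (fun=> c) = c.
Proof.
elim: n => [|n IH]//=; rewrite -[RHS]IH.
by apply: eq_history_mean => h _ _; rewrite draw_mean_cst.
Qed.

Lemma history_meanD n F G :
  history_mean n (fun h => F h + G h) = history_mean n F + history_mean n G.
Proof.
elim: n F G => [|n IH] F G//=; rewrite -IH.
by apply: eq_history_mean => h _ _; rewrite draw_meanD.
Qed.

Lemma history_meanZ n c F : history_mean n (fun h => c * F h) = c * history_mean n F.
Proof.
elim: n F => [|n IH] F//=; rewrite -IH.
by apply: eq_history_mean => h _ _; rewrite draw_meanZ.
Qed.

Fixpoint histories n : seq history :=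
  if n is m.+1 then
    [seq A :: h | h <- histories m, A <- enum_fset (draws (theta - 1) (vertices theta m))]
  else [:: [::]].

Lemma mem_histories n h : (h \in histories n) = valid_history h && (size h == n).
Proof.
elim: n h => [|n IH] h; first by case: h => [|A h]//=; rewrite andbF.
apply/allpairsP/andP => [[[h' A]/= []]|].
  by rewrite IH => /andP[v /eqP s] Ad ->/=; rewrite s v Ad eqxx.
case: h => [[]//|A h [/= /andP[Ad v]]]; rewrite eqSS => /eqP s.
by exists (h, A); rewrite IH v s eqxx; split; rewrite //= -s.
Qed.

Lemma uniq_histories n : uniq (histories n).
Proof.
elim: n => [|n IH]//=; apply: allpairs_uniq => //; first exact: fset_uniq.
by move=> [h A] [h' A'] _ _ /= [-> ->].
Qed.

(** The common probability of all valid histories of length [n]. *)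
Definition history_weight n : R := \prod_(k < n) ('C(k + theta, theta - 1)%:R)^-1.

Lemma history_meanE n F :
  history_mean n F = history_weight n * \sum_(h <- histories n) F h.
Proof.
elim: n F => [|n IH] F/=; first by rewrite /history_weight big_ord0 big_seq1 mul1r.
rewrite IH /history_weight big_ord_recr/= -mulrA; congr (_ * _).
by rewrite big_allpairs_dep/= mulrC mulr_suml.
Qed.

End history_mean.

(** * The law of the history *)

Section history.
Context (R : realType) (d : measure_display) (T : measurableType d).
Context (P : probability T R) (theta : nat).
Variable H : hyperrecursive_tree P theta.

Definition history n w : seq {fset nat} := rev (mkseq (fun k => chosen H k w) n).

Lemma historyS n w : history n.+1 w = chosen H n w :: history n w.
Proof. by rewrite /history mkseqS rev_rcons. Qed.

Lemma size_history n w : size (history n w) = n.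
Proof. by rewrite size_rev size_mkseq. Qed.

Lemma valid_history_history n w : valid_history theta (history n w).
Proof.
elim: n => [|n IH]//; rewrite historyS/= IH andbT size_history mem_draws.
by rewrite chosen_sub card_chosen eqxx.
Qed.

(** Gives the event the form of [past] in [chosen_indep_past]; [rev] restores chronological order,
    and the default [fset0] is never reached. *)
Lemma history_bigcap n h : size h = n -> [set w | history n w = h] =
  \bigcap_(k in `I_n) (chosen H k @^-1` [set nth fset0 (rev h) k]).
Proof.
move=> hn; apply/seteqP; split => [w /= <- k /= kn|w /= hw].
  by rewrite /history revK nth_mkseq.
apply: (can_inj revK); rewrite /history revK.
apply: (@eq_from_nth _ fset0); rewrite size_mkseq ?size_rev ?hn// => k kn.
by rewrite nth_mkseq// hw.
Qed.

Lemma measurable_history n h : measurable [set w | history n w = h].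
Proof.
have [hn|hn] := eqVneq (size h) n.
  rewrite history_bigcap//; apply: bigcap_measurableType => k _.
  by rewrite -[X in measurable X]setTI; exact: measurable_funPT.
rewrite (_ : [set _ | _] = set0)// -subset0 => w /= hh.
by move: hn; rewrite -hh size_history eqxx.
Qed.

Lemma prob_history n h : valid_history theta h -> size h = n ->
  P [set w | history n w = h] = (history_weight theta n : R)%:E.
Proof.
elim: n h => [|n IH] [|A h]//=.
  move=> _ _; rewrite /history_weight big_ord0 -(@probability_setT _ _ _ P).
  by congr (P _); apply/seteqP; split.
move=> /andP[]; rewrite mem_draws => /andP[AV /eqP Am] vh [hn].
(* With these singletons, the past is the event that the first draws form [h], and the event at time
   [n] is that the last draw is [A]. *)
have := chosen_indep_past H n (fun k => [set nth fset0 (rev (A :: h)) k]).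
have -> : \bigcap_(k in `I_n) (chosen H k @^-1` [set nth fset0 (rev (A :: h)) k])
    = [set w | history n w = h].
  rewrite history_bigcap//; apply: eq_bigcapr => k /= kn.
  by rewrite rev_cons nth_rcons size_rev hn kn.

rewrite /= rev_cons nth_rcons size_rev hn ltnn eqxx IH// chosen_uniform -?hn//.
rewrite -EFinM /history_weight big_ord_recr/= hn => <-; congr (P _).
by apply/seteqP; split => w /=; rewrite historyS => -[-> ->].
Qed.

Lemma prob_history_mem n (s : seq (seq {fset nat})) : uniq s ->
  P [set w | history n w \in s] = (\sum_(h <- s) P [set w | history n w = h])%E.
Proof.
elim: s => [|h s IH]/=.
  by move=> _; rewrite big_nil (_ : [set _ | _] = set0) ?measure0//; apply/seteqP; split.
move=> /andP[hs us]; rewrite big_cons -IH//.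
have ms : measurable [set w | history n w \in s].
  elim: (s) => [|h' s' ms'].
    by rewrite (_ : [set _ | _] = set0)//; apply/seteqP; split.
  rewrite (_ : [set _ | _] = [set w | history n w = h'] `|` [set w | history n w \in s']).
    by apply: measurableU => //; exact: measurable_history.
  by apply/seteqP; split => w /=; rewrite inE => /predU1P.
rewrite -measureU//; last 2 first.
- exact: measurable_history.
- by rewrite -subset0 => w [/= -> hs']; rewrite hs' in hs.
by congr (P _); apply/seteqP; split => w /=; rewrite inE => /predU1P.
Qed.

(** The bridge from [P] to finite averages: every history that occurs is valid, so the event is a
    finite disjoint union of equiprobable histories. *)
Lemma prob_history_pred n (Q : pred (seq {fset nat})) :
  P [set w | Q (history n w)] = (history_mean theta n (fun h => (Q h)%:R : R))%:E.
Proof.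
have -> : [set w | Q (history n w)] =
    [set w | history n w \in seq.filter Q (histories theta n)].
  by apply/seteqP; split => w /=;
    rewrite mem_filter mem_histories valid_history_history size_history eqxx /= andbT.
rewrite prob_history_mem ?filter_uniq ?uniq_histories// big_filter.
rewrite history_meanE mulr_sumr -sumEFin big_mkcond/= !big_seq.
apply: eq_bigr => h; rewrite mem_histories => /andP[vh /eqP hn].
by case: (Q h); rewrite ?mulr0// mulr1 prob_history.
Qed.

Lemma degree_eq0 n v w : v \notin vertices theta n -> degree H n v w = 0%N.
Proof.
rewrite mem_vertices -leqNgt => nv; apply: big1 => -[[|k] kn] _ /=.
  by rewrite mem_vertices add0n ltnNge (leq_trans _ nv) ?leq_addl.
rewrite !inE; have := kn; rewrite ltnS => {}kn.
rewrite gtn_eqF/=; last by rewrite (leq_trans _ nv)// ltn_add2r.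
apply/eqP; rewrite eqb0; apply/negP => vc.
have /fsubsetP/(_ _ vc) := chosen_sub H k w.
by rewrite mem_vertices ltnNge (leq_trans _ nv)// leq_add2r ltnW.
Qed.

Lemma degreeS n v w : degree H n.+1 v w = (degree H n v w + (v \in hyperedge H n.+1 w))%N.
Proof. by rewrite /degree big_ord_recr. Qed.

Lemma degree_gt0 n v w : v \in vertices theta n -> (0 < degree H n v w)%N.
Proof.
elim: n => [|n IH]; first by rewrite /degree big_ord1 => ->.
rewrite degreeS mem_vertices addSn ltnS leq_eqVlt => /orP[/eqP->|vn].
  by rewrite /= !inE eqxx addnC.
by rewrite ltn_addr// IH// mem_vertices.
Qed.

Lemma mem_degree1 n w v :
  (v \in [fset v in vertices theta n | degree H n v w == 1]%fset) =
  (v < n + theta)%N && (degree H n v w == 1).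
Proof. by rewrite -mem_vertices in_fset inE. Qed.

(** An existing vertex has positive degree, so it has degree one after a step iff it had degree one
    and was not chosen. The new vertex had degree zero, and gets its first hyperedge. *)
Lemma leaves_history n w : leaves theta (history n w) =
  [fset v in vertices theta n | degree H n v w == 1]%fset.
Proof.
elim: n => [|n IH].
  apply/fsetP => v; rewrite !inE/= /degree big_ord1/= mem_vertices.
  by rewrite mem_iota/=; case: ltnP.
rewrite historyS/= IH size_history; apply/fsetP => v.
rewrite in_fset1U in_fsetD !mem_degree1 degreeS.
have [->|vn] := eqVneq v (n + theta)%N.
  have d0 : degree H n (n + theta) w = 0%N.
    by rewrite degree_eq0// mem_vertices ltnn.
  by rewrite addSn ltnSn d0 /= !inE eqxx.
rewrite addSn ltnS ltn_neqAle vn/= in_fset1U (negbTE vn)/=.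
have [vn'|vn'] := leqP v (n + theta)%N; last by rewrite andbF.
have := @degree_gt0 n v w; rewrite mem_vertices ltn_neqAle vn vn' => /(_ isT).
by case: (_ \in chosen H n w); case: (degree H n v w) => [|[|k]].
Qed.

Lemma num_degree1E n w : num_degree H 1 n w = #|` leaves theta (history n w)|%fset%:R.
Proof. by rewrite leaves_history. Qed.

End history.

(** * The number of vertices of degree one *)

Section leaf_count.
Context {R : realType}.
Variable theta : nat.
Hypothesis theta2 : (2 <= theta)%N.
Local Notation t := (theta%:R : R).
Local Notation history := (seq {fset nat}).
Local Notation draw_mean := (@draw_mean R theta).
Local Notation history_mean := (@history_mean R theta).
Local Notation Phi := (@normal_cdf R 1).

Let t2 : 2 <= t. Proof. by rewrite ler_nat. Qed.

Lemma draw_mean_dist n F G (e : R) :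
  (forall A, A \in draws (theta - 1) (vertices theta n) -> `|F A - G A| <= e) ->
  `|draw_mean n F - draw_mean n G| <= e.
Proof.
move=> FG; rewrite ler_distl; apply/andP; split.
  rewrite -[e](draw_mean_cst theta n) -mulN1r -draw_meanZ -draw_meanD.
  by apply: le_draw_mean => A /FG; rewrite ler_distl mulN1r => /andP[].
rewrite -[e](draw_mean_cst theta n) -draw_meanD.
by apply: le_draw_mean => A /FG; rewrite ler_distl => /andP[].
Qed.

Lemma history_mean_dist n F G (B : history -> R) :
  (forall h, valid_history theta h -> size h = n -> `|F h - G h| <= B h) ->
  `|history_mean n F - history_mean n G| <= history_mean n B.
Proof.
move=> FG; rewrite ler_distl; apply/andP; split.
  rewrite -mulN1r -history_meanZ -history_meanD.
  apply: le_history_mean => h vh hn; have := FG h vh hn.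
  by rewrite ler_distl mulN1r => /andP[].
rewrite -history_meanD; apply: le_history_mean => h vh hn; have := FG h vh hn.
by rewrite ler_distl => /andP[].
Qed.

Definition leaf_count (h : history) : R := #|` leaves theta h|%fset%:R.

(* The mean of [leaf_count] is asymptotically [n / theta]; the shift by [1]
   makes the centred count a martingale up to the factors [contraction]. *)
Definition centered_count (h : history) : R :=
  leaf_count h - ((size h)%:R + t) / t.

Definition contraction n : R := (n%:R + 1) / (n%:R + t).

Definition noise (h : history) (A : {fset nat}) : R :=
  #|` leaves theta h `\` A|%fset%:R - contraction (size h) * leaf_count h.

Definition noise_var (h : history) : R := draw_mean (size h) (fun A => noise h A ^+ 2).

(** The value of [(t - 1) * (p * (1 - p))] at the limiting proportion [p = t^-1]. *)
Definition limit_noise_var : R := (t - 1) ^+ 2 / t ^+ 2.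

Lemma contraction01 n : 0 <= contraction n <= 1.
Proof.
have ht := t2.
have n0 : (0 : R) <= n%:R by [].
have N0 : 0 < n%:R + t by lra.
by rewrite /contraction divr_ge0 ?(ltW N0) ?addr_ge0//= ler_pdivrMr// mul1r; lra.
Qed.

Lemma centered_count_cons A h :
  centered_count (A :: h) = contraction (size h) * centered_count h + noise h A.
Proof.
have ht := t2.
rewrite /centered_count /noise /contraction /leaf_count card_leaves_cons.
rewrite [size (A :: h)]/= -!natr1.
have n0 : (0 : R) <= (size h)%:R by [].
by field; apply/andP; split; rewrite gt_eqF//; lra.
Qed.

Lemma leaf_count_ge0 h : 0 <= leaf_count h. Proof. by []. Qed.

Lemma leaf_count_le h : leaf_count h <= (size h)%:R + t.
Proof.
by rewrite -natrD ler_nat -(vertices_card theta) fsubset_leq_card ?leaves_sub.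
Qed.

Lemma draw_mean_noise h : draw_mean (size h) (noise h) = 0.
Proof.
have ht := t2.
rewrite [LHS](draw_meanD theta (size h) (fun A => #|` leaves theta h `\` A|%fset%:R)
  (fun=> - (contraction (size h) * leaf_count h))).
rewrite draw_mean_cst draw_mean_fsetD ?leaves_sub//.
rewrite natrD /contraction -/(leaf_count h); have n0 : (0 : R) <= (size h)%:R by [].
by field; rewrite gt_eqF//; lra.
Qed.

(** A draw removes at most [t - 1] vertices of degree one, so the count that remains and its mean
    both lie between [leaf_count h - (t - 1)] and [leaf_count h]. *)
Lemma noise_bound h A : A \in draws (theta - 1) (vertices theta (size h)) ->
  `|noise h A| <= t.
Proof.
have ht := t2.
rewrite mem_draws => /andP[_ /eqP Am].
have n0 : (0 : R) <= (size h)%:R by [].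
have N0 : 0 < (size h)%:R + t by lra.
have r1 : #|` leaves theta h `\` A|%fset%:R <= leaf_count h.
  by rewrite ler_nat fsubset_leq_card ?fsubsetDl.
have r2 : leaf_count h - (t - 1) <= #|` leaves theta h `\` A|%fset%:R.
  have -> : t - 1 = (theta - 1)%:R by rewrite natrB ?(ltnW theta2).
  rewrite -Am lerBlDr -natrD ler_nat -(cardfsID A) addnC.
  by rewrite leq_add2l fsubset_leq_card ?fsubsetIr.
have k0 := leaf_count_ge0 h; have kN := leaf_count_le h.
have c1 : contraction (size h) * leaf_count h <= leaf_count h.
  by rewrite ler_piMl//; case/andP: (contraction01 (size h)).
have c2 : leaf_count h - (t - 1) <= contraction (size h) * leaf_count h.
  rewrite /contraction (_ : _ * _ = leaf_count h -
    (t - 1) * (leaf_count h / ((size h)%:R + t))); last first.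
    by field; rewrite gt_eqF.
  rewrite lerB// ler_piMr//; first by lra.
  by rewrite ler_pdivrMr// mul1r.
by rewrite /noise ler_norml; lra.
Qed.

(** This is the hypergeometric variance for a sample of size [t - 1] from [n + t] vertices; the last
    factor is the finite-population correction. *)
Lemma noise_varE h : let n : R := (size h)%:R in let p := leaf_count h / (n + t) in
  noise_var h = (t - 1) * (p * (1 - p)) * ((n + 1) / (n + t - 1)).
Proof.
have ht := t2.
move=> n p.
rewrite /noise_var.
transitivity (draw_mean (size h) (fun A => #|` leaves theta h `\` A|%fset%:R ^+ 2) +
  (- (contraction (size h) * leaf_count h) ^+ 2 +
    - 2 * (contraction (size h) * leaf_count h) * draw_mean (size h) (noise h))).
  rewrite -draw_meanZ -[- _ ^+ 2](draw_mean_cst theta (size h)) -!draw_meanD.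
  congr draw_mean; apply/funext => A; rewrite /noise; ring.
rewrite draw_mean_noise mulr0 addr0.
rewrite (draw_mean_fsetD_sqr theta2 (leaves_sub theta h) erefl erefl).
rewrite /p /contraction -/(leaf_count h) natrD -/n.
have n0 : 0 <= n by exact: ler0n.
by field; apply/andP; split; rewrite gt_eqF//; lra.
Qed.

Lemma noise_var_dev h : `|noise_var h - limit_noise_var| <=
  t ^+ 2 * (1 + `|centered_count h|) / ((size h)%:R + 1).
Proof.
have ht := t2.
rewrite noise_varE /limit_noise_var; set n := (size h)%:R.
have n0 : 0 <= n by exact: ler0n.
have k0 := leaf_count_ge0 h; have kN := leaf_count_le h; rewrite -/n in kN.
have N0 : 0 < n + t by lra.
have N10 : 0 < n + t - 1 by lra.
have n10 : 0 < n + 1 by lra.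
set p := leaf_count h / (n + t).
have p0 : 0 <= p by rewrite /p divr_ge0 ?(ltW N0).
have p1 : p <= 1 by rewrite /p ler_pdivrMr ?mul1r.
have pE : p = t^-1 + centered_count h / (n + t).
  by rewrite /p /centered_count -/n; field; apply/andP; split; rewrite gt_eqF//; lra.
have t0 : 0 < t by lra.
have ti0 : 0 < t^-1 by rewrite invr_gt0.
have ti1 : t^-1 <= 1 by rewrite invf_le1//; lra.
(* The finite-population correction is [1 - u], with [u] of order 1 / n. *)
pose u := (t - 2) / (n + t - 1).
have -> : (n + 1) / (n + t - 1) = 1 - u.
  by rewrite /u; field; rewrite gt_eqF.
have u0 : 0 <= u by rewrite /u divr_ge0//; lra.
have u1 : u <= t / (n + 1).
  rewrite /u ler_pM ?invr_ge0 ?(ltW N10)//; try lra.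
  by rewrite lef_pV2 ?posrE//; lra.
pose g := `|centered_count h| / (n + 1).
have dp : `|p - t^-1| <= g.
  rewrite pE addrC addKr normrM normfV (gtr0_norm N0) ler_wpM2l//.
  by rewrite lef_pV2 ?posrE//; lra.
(* The difference of [p * (1 - p)] and its value at [t^-1] has the factor [p - t^-1], which is
   [centered_count h / (n + t)]. *)
have -> : (t - 1) * (p * (1 - p)) * (1 - u) - (t - 1) ^+ 2 / t ^+ 2 =
   (t - 1) * ((p - t^-1) * (1 - p - t^-1)) - (t - 1) * (p * (1 - p)) * u.
  by field; rewrite gt_eqF//; lra.
have g0 : 0 <= g by rewrite /g divr_ge0 ?(ltW n10).
have t10 : 0 <= t - 1 by lra.
have b1 : `|(t - 1) * ((p - t^-1) * (1 - p - t^-1))| <= (t - 1) * g.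
  rewrite normrM (ger0_norm t10) ler_wpM2l//.
  by rewrite normrM -[leRHS]mulr1 ler_pM// ler_norml; lra.
have b2 : `|(t - 1) * (p * (1 - p)) * u| <= (t - 1) * u.
  have q0 : 0 <= 1 - p by lra.
  have pp1 : p * (1 - p) <= 1 by rewrite mulr_ile1//; lra.
  rewrite ger0_norm; last by do 2!(apply: mulr_ge0 => //); exact: mulr_ge0.
  by rewrite ler_wpM2r// ler_piMr.
have -> : t ^+ 2 * (1 + `|centered_count h|) / (n + 1) = t * (t / (n + 1)) + t * t * g.
  by rewrite /g; field; rewrite gt_eqF.
apply: (le_trans (ler_normB _ _)).
apply: le_trans (lerD b1 b2) _; rewrite addrC lerD//.
  by rewrite ler_pM//; lra.
by rewrite ler_wpM2r//; nra.
Qed.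

(** Each step contracts the old value and adds a centred noise: the cross term averages to 0 and the
    square of the noise adds at most [t ^+ 2]. *)
Lemma mean_centered_count_sqr n :
  history_mean n (fun h => centered_count h ^+ 2) <= t ^+ 2 * (n%:R + 1).
Proof.
have ht := t2.
elim: n => [|n IH].
  rewrite /= /centered_count /leaf_count /= vertices_card !add0r mulr1 divff; last first.
    by rewrite gt_eqF//; lra.
  by nra.
apply: (@le_trans _ _ (history_mean n (fun h => centered_count h ^+ 2 + t ^+ 2))).
  rewrite [leLHS]/=; apply: le_history_mean => h vh hn.
  apply: (@le_trans _ _ (contraction n ^+ 2 * centered_count h ^+ 2 + t ^+ 2)); last first.
    rewrite lerD2r ler_piMl ?sqr_ge0// expr_le1//; by case/andP: (contraction01 n).
  apply: (@le_trans _ _ (draw_mean n (fun A =>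
      (contraction n ^+ 2 * centered_count h ^+ 2 + t ^+ 2) + 2 * contraction n * centered_count h * noise h A))).
    apply: le_draw_mean => A Ad; rewrite centered_count_cons hn.
    have := @noise_bound h A; rewrite hn => /(_ Ad).
    rewrite -(ler_sqr (normr_nneg _)) ?nnegrE// real_normK ?num_real//.
    by move: (noise h A) => x xt; rewrite sqrrD exprMn; lra.
  by rewrite draw_meanD draw_mean_cst draw_meanZ -hn draw_mean_noise mulr0 addr0.
rewrite history_meanD history_mean_cst -natr1.
by nra.
Qed.

Lemma mean_noise_var_dev n :
  history_mean n (fun h => `|noise_var h - limit_noise_var|)
    <= 2 * t ^+ 4 / Num.sqrt (n%:R + 1).
Proof.
have ht := t2.
have n10 : (0 : R) < n%:R + 1 by rewrite ltr_wpDl.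
pose s : R := Num.sqrt (n%:R + 1).
have s0 : 0 < s by rewrite sqrtr_gt0.
have s1 : 1 <= s by rewrite -[leLHS]sqrtr1 ler_wsqrtr// lerDr.
have sE : n%:R + 1 = s ^+ 2 by rewrite sqr_sqrtr ?ltW.
(* The inequality 2 |y| <= s + y^2 / s, with [s] of the typical size of [y], does the work of
   Cauchy-Schwarz and leaves only a second moment. *)
apply: (@le_trans _ _ (history_mean n (fun h =>
   t ^+ 2 * (1 + s / 2) / s ^+ 2 + t ^+ 2 / (2 * s ^+ 3) * centered_count h ^+ 2))).
  apply: le_history_mean => h vh hn; apply: le_trans (noise_var_dev h) _.
  rewrite hn sE.
  have -> : t ^+ 2 * (1 + s / 2) / s ^+ 2 + t ^+ 2 / (2 * s ^+ 3) * centered_count h ^+ 2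
    = t ^+ 2 * (1 + (s + centered_count h ^+ 2 / s) / 2) / s ^+ 2.
    by field; rewrite gt_eqF.
  rewrite ler_wpM2r ?invr_ge0 ?sqr_ge0// ler_wpM2l ?sqr_ge0// lerD2l.
  rewrite ler_pdivlMr// -[X in X / s]real_normK ?num_real//.
  set y := `|_|; have : 0 <= (s - y) ^+ 2 / s by rewrite divr_ge0 ?sqr_ge0 ?ltW.
  rewrite (_ : (s - y) ^+ 2 / s = s + y ^+ 2 / s - 2 * y); first by lra.
  by field; rewrite gt_eqF.
rewrite history_meanD history_mean_cst history_meanZ.
apply: (@le_trans _ _ (t ^+ 2 * (1 + s / 2) / s ^+ 2 +
  t ^+ 2 / (2 * s ^+ 3) * (t ^+ 2 * s ^+ 2))).
  rewrite lerD2l ler_wpM2l; last by rewrite -sE mean_centered_count_sqr.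
    by [].
  by rewrite divr_ge0 ?sqr_ge0// mulr_ge0// exprn_ge0 ?ltW.
have -> : t ^+ 2 * (1 + s / 2) / s ^+ 2 + t ^+ 2 / (2 * s ^+ 3) * (t ^+ 2 * s ^+ 2)
  = t ^+ 2 * (s^-1 + 1 / 2 + t ^+ 2 / 2) / s.
  by field; rewrite gt_eqF.
rewrite ler_wpM2r ?invr_ge0 ?(ltW s0)//.
have si : s^-1 <= 1 by rewrite invf_le1.
rewrite (_ : 2 * t ^+ 4 = t ^+ 2 * (2 * t ^+ 2)); last by ring.
by rewrite ler_wpM2l ?sqr_ge0//; nra.
Qed.

End leaf_count.

(** * Gaussian approximation *)

Section gaussian_approximation.
Context {R : realType}.
Variable theta : nat.
Hypothesis theta2 : (2 <= theta)%N.
Local Notation t := (theta%:R : R).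
Local Notation Phi := (@normal_cdf R 1).
Local Notation history_mean := (@history_mean R theta).
Local Notation contraction := (@contraction R theta).
Local Notation centered_count := (@centered_count R theta).
Local Notation v := (@limit_noise_var R theta).

(** The fraction of the initial value [centered_count [::]], which is [t - 1], that survives [n]
    steps. *)
Fixpoint mean_factor n : R :=
  if n is m.+1 then contraction m * mean_factor m else 1.

(* [limit_noise_var * var_factor n] approximates the variance after [n] steps. *)
Fixpoint var_factor n : R :=
  if n is m.+1 then 1 + contraction m ^+ 2 * var_factor m else 0.

Let t2 : 2 <= t. Proof. by rewrite ler_nat. Qed.

Lemma limit_noise_var01 : 0 <= v <= 1.
Proof.
have ht := t2; rewrite /limit_noise_var divr_ge0 ?sqr_ge0//=.
rewrite ler_pdivrMr ?exprn_gt0//; last by lra.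
by rewrite mul1r ler_sqr ?nnegrE; lra.
Qed.

Lemma mean_factor01 n : 0 <= mean_factor n <= 1.
Proof.
elim: n => [|n /andP[IH0 IH1]] /=; first by rewrite ler01 lexx.
have /andP[c0 c1] := @contraction01 R _ theta2 n.
by rewrite mulr_ge0//= mulr_ile1.
Qed.

(** The Lindeberg step is taken with [D] equal to [c] times the noise. Averaging kills the term in
    [p], as the noise is centred, and turns the term in [q] into the gap between [noise_var] and its
    limit. *)
Lemma draw_mean_lindeberg (K s c y : R) (h : seq {fset nat}) (p q : R) :
  0 < K -> 0 <= c <= 1 -> `|q| <= K ->
  let w := y - c * contraction (size h) * centered_count h in
  (forall D : R, `|Phi ((w - D) / Num.sqrt s) - Phi (w / Num.sqrt (s + v * c ^+ 2))
    - p * D - q * (D ^+ 2 - v * c ^+ 2)| <= K * (`|D| ^+ 3 + (v * c ^+ 2) ^+ 2)) ->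
  `|draw_mean theta (size h) (fun A =>
       Phi ((y - c * centered_count (A :: h)) / Num.sqrt s))
    - Phi (w / Num.sqrt (s + v * c ^+ 2))|
  <= K * c ^+ 2 * `|noise_var theta h - v| + K * (2 * t ^+ 3 * c ^+ 3).
Proof.
have ht := t2; move=> K0 /andP[c0 c1] qK w Hstep.
set B := Phi (w / Num.sqrt (s + v * c ^+ 2)).
have meanE : draw_mean theta (size h) (fun A =>
    B + p * (c * noise theta h A) + q * ((c * noise theta h A) ^+ 2 - v * c ^+ 2)) =
    B + q * c ^+ 2 * (noise_var theta h - v).
  transitivity (draw_mean theta (size h) (fun A => (B - q * (v * c ^+ 2)) +
      (p * c * noise theta h A + q * c ^+ 2 * noise theta h A ^+ 2))).
    congr draw_mean; apply/funext => A.
    ring.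
  rewrite !draw_meanD !draw_mean_cst !draw_meanZ draw_mean_noise//.
  by rewrite -/(noise_var theta h); ring.
have : `|draw_mean theta (size h) (fun A =>
       Phi ((y - c * centered_count (A :: h)) / Num.sqrt s)) -
    (B + q * c ^+ 2 * (noise_var theta h - v))| <= K * (2 * t ^+ 3 * c ^+ 3).
  rewrite -meanE; apply: draw_mean_dist => A Ad.
  have -> : y - c * centered_count (A :: h) = w - c * noise theta h A.
    by rewrite centered_count_cons// /w; ring.
  rewrite !opprD !addrA; apply: le_trans (Hstep _) _.
  rewrite ler_wpM2l ?(ltW K0)// normrM (ger0_norm c0) exprMn.
  have nt : `|noise theta h A : R| ^+ 3 <= t ^+ 3.
    by rewrite lerXn2r ?nnegrE ?noise_bound.
  have c3 : 0 <= c ^+ 3 by rewrite exprn_ge0.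
  have /andP[v0 v1] := limit_noise_var01.
  (* As [v] and [c] are at most 1, the [d ^+ 2] remainder is absorbed by the cubic one; this is the
     2 in [2 * t ^+ 3 * c ^+ 3]. *)
  have vc : (v * c ^+ 2) ^+ 2 <= c ^+ 3.
    rewrite exprMn -exprM (_ : (2 * 2 = 1 + 3)%N)// exprD expr1.
    rewrite -[leRHS]mul1r mulrA ler_wpM2r// mulr_ile1 ?sqr_ge0// expr_le1//.
  have t3 : 1 <= t ^+ 3 by rewrite exprn_ege1//; lra.
  move: nt c3 vc t3; move: (`|_| ^+ 3) (t ^+ 3) (c ^+ 3) (_ ^+ 2) => a b e f h1 h2 h3 h4.
  by nra.
move=> Hm.
have -> : forall x : R, x - B = (x - (B + q * c ^+ 2 * (noise_var theta h - v))) +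
   q * c ^+ 2 * (noise_var theta h - v) by move=> x; ring.
apply: le_trans (ler_normD _ _) _; rewrite addrC lerD//.
by rewrite 2!normrM ler_wpM2r// (ger0_norm (sqr_ge0 c)) ler_wpM2r ?sqr_ge0.
Qed.

(** A telescoping bound: it makes the sum of the first [n] terms at most 2 sqrt n. *)
Lemma sqrt_natS_ge n : (Num.sqrt (n%:R + 1))^-1 <=
  2 * (Num.sqrt (n%:R + 1) - Num.sqrt n%:R) :> R.
Proof.
have n0 : (0 : R) <= n%:R by [].
set a := Num.sqrt (n%:R + 1); set b := Num.sqrt n%:R.
have a0 : 0 < a by rewrite sqrtr_gt0 ltr_wpDl.
have b0 : 0 <= b by rewrite sqrtr_ge0.
have ab : a ^+ 2 = b ^+ 2 + 1 by rewrite !sqr_sqrtr// addr_ge0.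
rewrite -[leLHS]mul1r ler_pdivrMr//.
have := sqr_ge0 (a - b); nra.
Qed.

(** Induction with [c] and [s] free: averaging out the last draw replaces them by
    [c * contraction n] and [s + v * c ^+ 2], the recursion behind [mean_factor] and [var_factor].
    One [K] serves all steps because [s] only grows and [c] only shrinks; the 4 is the 2 of
    [mean_noise_var_dev] times the 2 of the telescoping bound. *)
Lemma history_mean_lindeberg (eta : R) : 0 < eta -> exists2 K : R, 0 < K &
  forall n c s y, 0 <= c <= 1 -> eta <= s ->
  `|history_mean n (fun h => Phi ((y - c * centered_count h) / Num.sqrt s))
    - Phi ((y - c * mean_factor n * (t - 1)) /
        Num.sqrt (s + v * c ^+ 2 * var_factor n))|
  <= K * (4 * t ^+ 4 * c ^+ 2 * Num.sqrt n%:R + 2 * t ^+ 3 * c ^+ 3 * n%:R).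
Proof.
have ht := t2; move=> /normal_cdf_lindeberg_step[K K0 HK]; exists K => //.
elim=> [|n IH] c s y c01 etas.
  rewrite /= sqrtr0 !mulr0 !addr0 mulr0 mulr1.
  have -> : centered_count [::] = t - 1.
    by rewrite /centered_count /leaf_count/= vertices_card !add0r divff ?gt_eqF//; lra.
  by rewrite subrr normr0.
have /andP[c0 c1] := c01.
have /andP[g0 g1] := @contraction01 R _ theta2 n.
have /andP[v0 v1] := limit_noise_var01.
pose c' := c * contraction n.
have c'c : c' <= c by rewrite ler_piMr.
have c'0 : 0 <= c' by rewrite mulr_ge0.
have c'01 : 0 <= c' <= 1 by rewrite c'0 (le_trans c'c).
pose s' := s + v * c ^+ 2.
have d0 : 0 <= v * c ^+ 2 by rewrite mulr_ge0 ?sqr_ge0.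
have etas' : eta <= s' by rewrite (le_trans etas) ?lerDl.
have := IH c' s' y c'01 etas'.
set E' := history_mean n _; set P' := Phi _.
have -> : c * mean_factor n.+1 = c' * mean_factor n by rewrite /c' -mulrA.
have -> : s + v * c ^+ 2 * var_factor n.+1 = s' + v * c' ^+ 2 * var_factor n.
  rewrite /s' /c' [var_factor n.+1]/=.
  by move: (contraction n) (var_factor n) v => *; ring.
move=> IHn.
rewrite -(subrK E' (history_mean _ _)) -addrA.
apply: le_trans (ler_normD _ _) _.
have step : `|history_mean n.+1 (fun h => Phi ((y - c * centered_count h) / Num.sqrt s))
    - E'| <= K * c ^+ 2 * (2 * t ^+ 4 / Num.sqrt (n%:R + 1)) + K * (2 * t ^+ 3 * c ^+ 3).
  apply: (@le_trans _ _ (history_mean n (fun h => K * (2 * t ^+ 3 * c ^+ 3) +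
      K * c ^+ 2 * `|noise_var theta h - v|))).
    rewrite [history_mean n.+1 _]/=; apply: history_mean_dist => h vh hn.
    have [p [q [qK Hpq]]] := HK s (v * c ^+ 2)
      (y - c * contraction (size h) * centered_count h) etas d0.
    have := draw_mean_lindeberg K0 c01 qK Hpq.
    by rewrite hn [X in _ -> _ <= X]addrC.
  rewrite history_meanD history_mean_cst history_meanZ addrC lerD2r.
  by rewrite ler_wpM2l ?mulr_ge0 ?sqr_ge0 ?(ltW K0)// mean_noise_var_dev.
apply: le_trans (lerD step IHn) _.
have t3 : 0 <= 2 * t ^+ 3 by rewrite mulr_ge0// exprn_ge0//; lra.
have t4 : 0 <= 2 * t ^+ 4 by rewrite mulr_ge0// exprn_ge0//; lra.
have e2 : c' ^+ 2 <= c ^+ 2 by rewrite ler_sqr.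
have e3 : c' ^+ 3 <= c ^+ 3 by rewrite lerXn2r.
have n0 : (0 : R) <= n%:R by [].
rewrite -(mulrA K (c ^+ 2)) -2!(mulrDr K) ler_wpM2l ?(ltW K0)//.
have sq := sqrt_natS_ge n.
have a1 : 4 * t ^+ 4 * c' ^+ 2 * Num.sqrt n%:R <= 4 * t ^+ 4 * c ^+ 2 * Num.sqrt n%:R.
  by rewrite ler_wpM2r ?sqrtr_ge0// ler_wpM2l//; lra.
have a2 : 2 * t ^+ 3 * c' ^+ 3 * n%:R <= 2 * t ^+ 3 * c ^+ 3 * n%:R.
  by rewrite ler_wpM2r// ler_wpM2l//; lra.
have a3 : 2 * t ^+ 4 * c ^+ 2 * (Num.sqrt (n%:R + 1))^-1 <=
    2 * t ^+ 4 * c ^+ 2 * (2 * (Num.sqrt (n%:R + 1) - Num.sqrt n%:R)).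
  by rewrite ler_wpM2l// mulr_ge0 ?sqr_ge0.
move: a1 a2 a3; rewrite -[n.+1%:R]natr1.
move: (Num.sqrt (n%:R + 1)) (Num.sqrt n%:R) => r1 r0.
move: (t ^+ 4) (t ^+ 3) (c ^+ 2) (c ^+ 3) (c' ^+ 2) (c' ^+ 3) n%:R r1^-1.
move=> T4 T3 C2 C3 C2' C3' m ri a1 a2 a3.
by lra.
Qed.

End gaussian_approximation.

(** * Convergence in distribution *)

Section limit.
Context {R : realType}.
Variable theta : nat.
Hypothesis theta2 : (2 <= theta)%N.
Local Notation t := (theta%:R : R).
Local Notation Phi := (@normal_cdf R 1).
Local Notation history_mean := (@history_mean R theta).
Local Notation centered_count := (@centered_count R theta).
Local Notation v := (@limit_noise_var R theta).
Local Notation var_factor := (@var_factor R theta).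

Let t2 : 2 <= t. Proof. by rewrite ler_nat. Qed.

Definition limit_var : R := (t - 1) ^+ 2 / (t ^+ 2 * (2 * t - 1)).

Lemma limit_var_gt0 : 0 < limit_var.
Proof.
have ht := t2; rewrite /limit_var divr_gt0 ?mulr_gt0 ?exprn_gt0//; lra.
Qed.

Lemma continuous_Phi : continuous Phi.
Proof.
move=> x; have := @is_derive_normal_cdf R 1 x (oner_neq0 R).
exact: is_derive1_continuous.
Qed.

Lemma cvg_inv_sqrt : (Num.sqrt n%:R)^-1 @[n --> \oo] --> (0 : R).
Proof.
have -> : (fun n => (Num.sqrt n%:R)^-1) = (fun n => Num.sqrt n%:R^-1) :> (R ^nat).
  by apply/funext => n; rewrite sqrtrV.
rewrite -[X in _ --> X]sqrtr0; apply: continuous_cvg; first exact: sqrt_continuous.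
rewrite -(cvg_shiftS (fun n => n%:R^-1 : R)).
exact: cvg_harmonic.
Qed.

(** The rate is an inverse square root of [n], which is 0 by convention at [n = 0]; hence the
    restriction to positive [n]. *)
Lemma cvg_dist_le (u w r : R ^nat) (C l : R) :
  (forall n, (0 < n)%N -> `|u n - w n| <= C * r n) ->
  r n @[n --> \oo] --> (0 : R) -> w n @[n --> \oo] --> l ->
  u n @[n --> \oo] --> l.
Proof.
move=> uw r0 wl.
have uw0 : (u n - w n) @[n --> \oo] --> (0 : R).
  apply/norm_cvg0P; apply: (@squeeze_cvgr _ _ _ _ (cst 0) (fun n => C * r n)).
  - by exists 1%N => // n /= n0; rewrite normr_ge0/= uw.
  - exact: cvg_cst.
  - by rewrite -[X in _ --> X](mulr0 C); apply: cvgM => //; exact: cvg_cst.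
rewrite (_ : u = (fun n => (u n - w n) + w n)); last first.
  by apply/funext => n; rewrite subrK.
by rewrite -[l]add0r; exact: cvgD.
Qed.

(** The linear function [(n + t) / (2 * t - 1)] solves the recursion of [var_factor] up to an error
    of order 1 / n, and the contraction does not amplify earlier errors. *)
Lemma var_factor_dev n :
  `|var_factor n - (n%:R + t) / (2 * t - 1)| <= t + 2 * t ^+ 2 * Num.sqrt n%:R.
Proof.
have ht := t2; elim: n => [|n IH].
  rewrite /= sqrtr0 mulr0 addr0 !add0r normrN ger0_norm ?divr_ge0//; last by lra.
  by rewrite ler_pdivrMr; nra.
have n0 : (0 : R) <= n%:R by [].
have /andP[g0 g1] := @contraction01 R _ theta2 n.
have -> : var_factor n.+1 - (n.+1%:R + t) / (2 * t - 1) =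
   contraction theta n ^+ 2 * (var_factor n - (n%:R + t) / (2 * t - 1)) +
   (t - 1) ^+ 2 / ((n%:R + t) * (2 * t - 1)).
  rewrite [var_factor n.+1]/= /contraction -natr1.
  by field; apply/andP; split; rewrite gt_eqF//; lra.
apply: le_trans (ler_normD _ _) _.
set e := _ - _ in IH *.
have b1 : `|contraction theta n ^+ 2 * e| <= `|e|.
  by rewrite normrM ler_piMl// ger0_norm ?sqr_ge0// expr_le1.
(* A crude bound on the residual, in the form that the telescoping of square roots can sum. *)
have b2 : `|(t - 1) ^+ 2 / ((n%:R + t) * (2 * t - 1))| <=
    t ^+ 2 / Num.sqrt (n%:R + 1).
  have s1 : 1 <= Num.sqrt (n%:R + 1 : R).
    by rewrite -[leLHS]sqrtr1 ler_wsqrtr// lerDr.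
  have ss : Num.sqrt (n%:R + 1 : R) ^+ 2 = n%:R + 1 by rewrite sqr_sqrtr// addr_ge0.
  have p0 : 0 < (n%:R + t) * (2 * t - 1) by rewrite mulr_gt0//; lra.
  rewrite ger0_norm; last by rewrite divr_ge0 ?sqr_ge0 ?ltW.
  apply: ler_pM; rewrite ?sqr_ge0 ?invr_ge0 ?(ltW p0)//.
    by rewrite ler_sqr ?nnegrE; lra.
  have s0 : 0 < Num.sqrt (n%:R + 1 : R) by exact: lt_le_trans s1.
  have sn : Num.sqrt (n%:R + 1 : R) <= n%:R + 1.
    by rewrite -[leRHS]ss expr2 ler_peMl ?(ltW s0).
  have nt : n%:R + t <= (n%:R + t) * (2 * t - 1) by rewrite ler_peMr; lra.
  by rewrite lef_pV2 ?posrE//; lra.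
have b3 := @sqrt_natS_ge R n.
have b4 : t ^+ 2 / Num.sqrt (n%:R + 1) <=
    t ^+ 2 * (2 * (Num.sqrt (n%:R + 1) - Num.sqrt n%:R)).
  by rewrite ler_wpM2l ?sqr_ge0.
rewrite -[n.+1%:R]natr1.
apply: le_trans (lerD b1 b2) _.
apply: le_trans (lerD IH b4) _.
by move: (Num.sqrt _) (Num.sqrt _) (t ^+ 2) => *; lra.
Qed.

Lemma sqrtn_gt0 n : (0 < n)%N -> 0 < Num.sqrt (n%:R : R).
Proof. by rewrite sqrtr_gt0 ltr0n. Qed.

Lemma cvg_var_factor :
  ((Num.sqrt n%:R)^-1 ^+ 2 * var_factor n) @[n --> \oo] --> (2 * t - 1)^-1.
Proof.
have ht := t2.
apply: (@cvg_dist_le _ (fun=> (2 * t - 1)^-1) _ (4 * t ^+ 2)) cvg_inv_sqrt _; last first.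
  exact: cvg_cst.
move=> n n0; have s0 := sqrtn_gt0 n0.
have s1 : 1 <= Num.sqrt (n%:R : R) by rewrite -[leLHS]sqrtr1 ler_wsqrtr// ler1n.
have sE : n%:R = Num.sqrt (n%:R : R) ^+ 2 by rewrite sqr_sqrtr.
have := var_factor_dev n; rewrite {1}sE.
move: (Num.sqrt _) s0 s1 (var_factor n) {sE} => s s0 s1 Q Qdev.
have -> : s^-1 ^+ 2 * Q - (2 * t - 1)^-1 =
    s^-1 ^+ 2 * ((Q - (s ^+ 2 + t) / (2 * t - 1)) + t / (2 * t - 1)).
  by field; apply/andP; split; rewrite gt_eqF//; lra.
rewrite normrM ger0_norm ?sqr_ge0//.
apply: (@le_trans _ _ (s^-1 ^+ 2 * (4 * t ^+ 2 * s))).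
  rewrite ler_wpM2l ?sqr_ge0// (le_trans (ler_normD _ _))//.
  have tt : `|t / (2 * t - 1)| <= t.
    by rewrite ger0_norm ?divr_ge0//; [rewrite ler_pdivrMr; nra|lra].
  apply: le_trans (lerD Qdev tt) _.
  by nra.
rewrite le_eqVlt; apply/orP; left; apply/eqP.
by field; rewrite gt_eqF.
Qed.

Lemma limit_noise_var_div : v / (2 * t - 1) = limit_var.
Proof.
have ht := t2; rewrite /limit_noise_var /limit_var.
by field; apply/andP; split; rewrite gt_eqF//; lra.
Qed.

Definition scaled_count n h : R := (leaf_count theta h - n%:R / t) * (Num.sqrt n%:R)^-1.

Lemma cvg_history_mean_Phi (y eps : R) : 0 < eps ->
  history_mean n (fun h => Phi ((y - scaled_count n h) / eps)) @[n --> \oo] -->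
  Phi (y / Num.sqrt (eps ^+ 2 + limit_var)).
Proof.
move=> e0; have ht := t2.
have [K K0 HK] := history_mean_lindeberg theta2 (exprn_gt0 2 e0).
pose c n : R := (Num.sqrt n%:R)^-1.
(* The centring of [centered_count] exceeds [n / theta] by 1, hence the shift of [y] by [c n]. Both
   error terms have order [c n], since c^2 sqrt n = c^3 n = c. *)
apply: (@cvg_dist_le _ (fun n =>
  Phi ((y - c n - c n * mean_factor theta n * (t - 1)) /
        Num.sqrt (eps ^+ 2 + v * c n ^+ 2 * var_factor n)))
  c (K * (4 * t ^+ 4 + 2 * t ^+ 3))); [|exact: cvg_inv_sqrt|].
  move=> n n0; have s0 := sqrtn_gt0 n0.
  have s1 : 1 <= Num.sqrt (n%:R : R) by rewrite -[leLHS]sqrtr1 ler_wsqrtr// ler1n.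
  have sE : n%:R = Num.sqrt (n%:R : R) ^+ 2 by rewrite sqr_sqrtr.
  have c01 : 0 <= c n <= 1 by rewrite /c invr_ge0 (ltW s0)/= invf_le1.
  have := HK n (c n) (eps ^+ 2) (y - c n) c01 (lexx _).
  have -> : history_mean n (fun h =>
      Phi ((y - c n - c n * centered_count h) / Num.sqrt (eps ^+ 2)))
      = history_mean n (fun h => Phi ((y - scaled_count n h) / eps)).
    apply: eq_history_mean => h _ hn; rewrite sqrtr_sqr (gtr0_norm e0).
    have -> // : y - c n - c n * centered_count h = y - scaled_count n h.
    rewrite /scaled_count /centered_count -/(c n) hn.
    by move: (c n) => r; field; rewrite gt_eqF//; lra.
  move=> /le_trans; apply.
  rewrite -[leRHS]mulrA ler_wpM2l ?(ltW K0)// {2}sE /c.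
  rewrite le_eqVlt; apply/orP; left; apply/eqP.
  by move: (Num.sqrt _) s0 => s s0; field; rewrite gt_eqF.
apply: continuous_cvg; first exact: continuous_Phi.
have c0 : c n @[n --> \oo] --> (0 : R) by exact: cvg_inv_sqrt.
have l0 := limit_var_gt0.
apply: cvgM.
  rewrite -[X in _ --> X]subr0; apply: cvgB.
    by rewrite -[X in _ --> X]subr0; apply: cvgB => //; exact: cvg_cst.
  apply: (@cvg_dist_le _ (fun=> 0) c (t - 1)) => //; last exact: cvg_cst.
  move=> n n0; have /andP[m0 m1] := mean_factor01 (R := R) theta2 n.
  have cn0 : 0 <= c n by rewrite invr_ge0 sqrtr_ge0.
  rewrite subr0 ger0_norm; last by rewrite !mulr_ge0//; lra.
  rewrite mulrC ler_wpM2l//; first by lra.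
  by rewrite ler_piMr.
apply: cvgV; first by rewrite gt_eqF// sqrtr_gt0 addr_gt0// exprn_gt0.
apply: continuous_cvg; first exact: sqrt_continuous.
apply: cvgD; first exact: cvg_cst.
rewrite -limit_noise_var_div.
have -> : (fun n => v * c n ^+ 2 * var_factor n) =
    (fun n => v * (c n ^+ 2 * var_factor n)).
  by apply/funext => n; rewrite mulrA.
by apply: cvgM; [exact: cvg_cst|exact: cvg_var_factor].
Qed.

(** Shift [d] and width [d ^+ 2]: both vanish with [d], yet at [z = x] the argument is plus or minus
    [d^-1], so the tails vanish too and a single parameter suffices. *)
Lemma smoothed_indicator (x z d : R) : 0 < d ->
  Phi ((x - d - z) / d ^+ 2) - Phi (- d^-1) <= (z <= x)%R%:R <=
  Phi ((x + d - z) / d ^+ 2) + (1 - Phi d^-1).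
Proof.
move=> d0; have dd : d / d ^+ 2 = d^-1 by field; rewrite gt_eqF.
have mono : {homo Phi : x y / x <= y} := @normal_cdf_nondecreasing R 1.
have d20 : 0 <= (d ^+ 2)^-1 by rewrite invr_ge0 sqr_ge0.
case: (lerP z x) => zx; rewrite ?mulr1n ?mulr0n.
  have h1 : Phi d^-1 <= Phi ((x + d - z) / d ^+ 2).
    by rewrite -dd; apply: mono; rewrite ler_wpM2r//; lra.
  have h2 := normal_cdf_le1 1 ((x - d - z) / d ^+ 2).
  have h3 := normal_cdf_ge0 1 (- d^-1).
  by apply/andP; split; lra.
have h1 : Phi ((x - d - z) / d ^+ 2) <= Phi (- d^-1).
  by rewrite -dd -mulNr; apply: mono; rewrite ler_wpM2r//; lra.
have h2 := normal_cdf_ge0 1 ((x + d - z) / d ^+ 2).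
have h3 := normal_cdf_le1 1 d^-1.
by apply/andP; split; lra.
Qed.

Lemma cvg_scaled_count_cdf (x : R) :
  history_mean n (fun h => (scaled_count n h <= x)%R%:R) @[n --> \oo] -->
  Phi (x / Num.sqrt limit_var).
Proof.
have l0 := limit_var_gt0.
have smooth (s : R) :
    Phi ((x + s * d) / Num.sqrt ((d ^+ 2) ^+ 2 + limit_var)) @[d --> 0^'+] -->
    Phi (x / Num.sqrt limit_var).
  apply: cvg_at_right_filter.
  apply: continuous_cvg; first exact: continuous_Phi.
  apply: cvgM.
    have : x + s * d @[d --> 0] --> x + s * 0.
      by apply: cvgD; [exact: cvg_cst|exact: mulrl_continuous].
    by rewrite mulr0 addr0.
  apply: cvgV; first by rewrite gt_eqF// sqrtr_gt0.
  apply: continuous_cvg; first exact: sqrt_continuous.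
  rewrite -[X in _ --> X]add0r; apply: cvgD; last exact: cvg_cst.
  have -> : (fun d : R => (d ^+ 2) ^+ 2) = (fun d => d ^+ 4).
    by apply/funext => d; rewrite -exprM.
  by rewrite -[X in _ --> X](expr0n R 4); exact: exprn_continuous.
have inv_y : d^-1 @[d --> (0 : R)^'+] --> +oo.
  apply/(cvgrVy (f := id)); first exact: nbhs_right_gt.
  by apply: cvg_at_right_filter; exact: cvg_id.
have tail1 : Phi d^-1 @[d --> (0 : R)^'+] --> (1 : R).
  exact: cvg_comp inv_y (normal_cdf_cvgy 1).
have tail0 : Phi (- d^-1) @[d --> (0 : R)^'+] --> (0 : R).
  apply: cvg_comp (normal_cdf_cvgNy 1).
  exact/cvgNrNy.
apply/cvgrPdist_lt => e e0.
have e40 : 0 < e / 4 by rewrite divr_gt0.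
(* [d] is fixed before [n]. Each side of the sandwich spends three quarters of [e]: on the tail, on
   the smoothed limit and, for large [n], on the convergence of the smoothed mean. *)
have [d [d0 hp hm h1 h0]] : exists d : R, [/\ 0 < d,
    `|Phi (x / Num.sqrt limit_var) -
      Phi ((x + 1 * d) / Num.sqrt ((d ^+ 2) ^+ 2 + limit_var))| < e / 4,
    `|Phi (x / Num.sqrt limit_var) -
      Phi ((x + -1 * d) / Num.sqrt ((d ^+ 2) ^+ 2 + limit_var))| < e / 4,
    `|1 - Phi d^-1| < e / 4 & `|0 - Phi (- d^-1)| < e / 4].
  have /cvgrPdist_lt/(_ _ e40) n1 := smooth 1.
  have /cvgrPdist_lt/(_ _ e40) n2 := smooth (-1).
  have /cvgrPdist_lt/(_ _ e40) n3 := tail1.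
  have /cvgrPdist_lt/(_ _ e40) n4 := tail0.
  near (0 : R)^'+ => d; exists d; split; near: d;
    [exact: nbhs_right_gt|exact: n1|exact: n2|exact: n3|exact: n4].
have d20 : 0 < d ^+ 2 by rewrite exprn_gt0.
have /cvgrPdist_lt/(_ _ e40) up := cvg_history_mean_Phi (y := x + d) d20.
have /cvgrPdist_lt/(_ _ e40) lo := cvg_history_mean_Phi (y := x - d) d20.
near=> n.
have up' : `|Phi ((x + d) / Num.sqrt ((d ^+ 2) ^+ 2 + limit_var)) -
   history_mean n (fun h => Phi ((x + d - scaled_count n h) / d ^+ 2))| < e / 4.
  by near: n; exact: up.
have lo' : `|Phi ((x - d) / Num.sqrt ((d ^+ 2) ^+ 2 + limit_var)) -
   history_mean n (fun h => Phi ((x - d - scaled_count n h) / d ^+ 2))| < e / 4.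
  by near: n; exact: lo.
have upper : history_mean n (fun h => (scaled_count n h <= x)%R%:R) <=
    history_mean n (fun h => Phi ((x + d - scaled_count n h) / d ^+ 2)) + (1 - Phi d^-1).
  rewrite -[1 - _](@history_mean_cst R theta n) -history_meanD.
  apply: le_history_mean => h _ _.
  by have /andP[] := smoothed_indicator x (scaled_count n h) d0.
have lower : history_mean n (fun h => Phi ((x - d - scaled_count n h) / d ^+ 2)) - Phi (- d^-1)
    <= history_mean n (fun h => (scaled_count n h <= x)%R%:R).
  rewrite -[- Phi _](@history_mean_cst R theta n) -history_meanD.
  apply: le_history_mean => h _ _.
  by have /andP[] := smoothed_indicator x (scaled_count n h) d0.
rewrite mul1r in hp; rewrite mulN1r in hm.
move: upper lower up' lo' hp hm h1 h0; rewrite !ltr_distl.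
move: (history_mean n _) (history_mean n _) (history_mean n _) => E1 E2 E3.
move: (Phi _) (Phi _) (Phi _) (Phi _) (Phi _) => p1 p2 p3 p4 p5.
move=> ? ? /andP[? ?] /andP[? ?] /andP[? ?] /andP[? ?] /andP[? ?] /andP[? ?].
by apply/andP; split; lra.
Unshelve. all: by end_near. Qed.

End limit.

Theorem theorem5p2 (R : realType) (d : measure_display) (T : measurableType d)
    (P : probability T R) (theta : nat) (theta2 : (2 <= theta)%N)
    (H : hyperrecursive_tree P theta) :
  let X (n : nat) : {RV P >-> R} := num_degree H 1 n in
  (* the second parameter of normal_prob is the standard deviation *)
  cvg_in_distribution
    (fun n => (X n \- cst (n%:R / theta%:R)) \* cst (Num.sqrt n%:R)^-1
              : {RV P >-> R})
    (normal_prob 0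
      (Num.sqrt ((theta%:R - 1) ^+ 2 / (theta%:R ^+ 2 * (2 * theta%:R - 1))))).
Proof.
move=> X x _.
have s0 : 0 < Num.sqrt (limit_var theta : R) by rewrite sqrtr_gt0 limit_var_gt0.
rewrite -[X in _ --> X]/(normal_prob 0 (Num.sqrt (limit_var theta)) `]-oo, x]).
rewrite normal_cdfE (normal_cdf_scale _ s0).
rewrite (_ : (fun n => cdf _ x) = (fun n => (history_mean theta n
    (fun h => (scaled_count theta n h <= x)%R%:R : R))%:E)).
  apply: cvg_EFin; first exact: nearW.
  exact: cvg_scaled_count_cdf.
apply/funext => n; rewrite -(prob_history_pred H); congr (P _).
by apply/seteqP; split => w /=; rewrite in_itv/= num_degree1E.
Qed.
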